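(* Let $(V,\sigma)$ be a braided vector space. Then the quintuple $(\overline{\mathcal{P}(V)},\prec_\sigma,\succ_\sigma,\cdot_\sigma,\sigma_{AT})$, together with the map $i_V:V\to\overline{\mathcal{P}(V)}$, $v\mapsto T[v]$, is the free braided tridendriform algebra on $(V,\sigma)$, characterized by the following universal property: for any braided tridendriform algebra $(R,\prec_R,\succ_R,\cdot_R,\tau)$ and any homomorphism $\varphi:V\to R$ of braided vector spaces, there exists a unique homomorphism $\bar\varphi:\overline{\mathcal{P}(V)}\to R$ of braided tridendriform algebras such that $\varphi=\bar\varphi\circ i_V$.
   Context: Ground field $\mathbf{k}$ of characteristic $0$; all vector spaces, algebras and tensor products are over $\mathbf{k}$. Braidings. A braiding on a vector space $V$ is a linear map $\sigma\in\mathrm{End}(V\otimes V)$ with $(\sigma\otimes \mathrm{id})(\mathrm{id}\otimes\sigma)(\sigma\otimes \mathrm{id})=(\mathrm{id}\otimes\sigma)(\sigma\otimes \mathrm{id})(\mathrm{id}\otimes\sigma)$ on $V^{\otimes3}$ (invertibility is not required); $(V,\sigma)$ is then a braided vector space. A homomorphism $f:(V,\sigma)\to(V',\sigma')$ of braided vector spaces is a linear map with $(f\otimes f)\sigma=\sigma'(f\otimes f)$. For an operator on two adjacent tensor factors, the subscript $i$ (as in $\sigma_i$) means it acts on the $i$-th and $(i+1)$-th factors. For $w\in\mathfrak{S}_n$ with reduced expression $w=s_{i_1}\cdots s_{i_l}$ put $T^\sigma_w=\sigma_{i_1}\cdots\sigma_{i_l}$ on $V^{\otimes n}$; when $\sigma$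 is the flip, $T_w(v_1\otimes\cdots\otimes v_n)=v_{w^{-1}(1)}\otimes\cdots\otimes v_{w^{-1}(n)}$. For $i,j\ge1$ let $\beta_{ij}=T^\sigma_{\chi_{ij}}:V^{\otimes i}\otimes V^{\otimes j}\to V^{\otimes j}\otimes V^{\otimes i}$, where $\chi_{ij}\in\mathfrak{S}_{i+j}$ sends $a\mapsto j+a$ for $1\le a\le i$ and $i+b\mapsto b$ for $1\le b\le j$; $\beta_{0i}=\beta_{i0}=\mathrm{id}$. Braided tridendriform algebras. A tridendriform algebra $(R,\prec,\succ,\cdot)$ is a vector space with three bilinear operations satisfying, with $*:=\prec+\succ+\cdot$: $(x\prec y)\prec z=x\prec(y*z)$; $(x\succ y)\prec z=x\succ(y\prec z)$; $x\succ(y\succ z)=(x*y)\succ z$; $(x\cdot y)\prec z=x\cdot(y\prec z)$; $(x\prec y)\cdot z=x\cdot(y\succ z)$; $(x\succ y)\cdot z=x\succ(y\cdot z)$; $(x\cdot y)\cdot z=x\cdot(y\cdot z)$. A braided tridendriform algebra $(R,\prec,\succ,\cdot,\sigma)$ is a tridendriform algebra with a braiding $\sigma$ on $R$ such that for each $\odot\in\{\prec,\succ,\cdot\}$, $\sigma(\mathrm{id}\otimes\odot)=(\odot\otimes\mathrm{id})\sigma_2\sigma_1$ and $\sigma(\odot\otimes\mathrm{id})=(\mathrm{id}\otimes\odot)\sigma_1\sigma_2$. Homomorphisms are linear maps preserving the three operations and commuting with the braidings. Angularly decorated trees. $\mathcal{D}_n$ is the set of planar rooted trees with $n+1$ leaves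 in which every internal vertex has at least two branches (incoming edges); $\mathcal{D}_0=\{|\}$. A tree in $\mathcal{D}_n$ has exactly $n$ angles (between adjacent branches at internal vertices), ordered from left to right: the $i$-th angle is the one located between the $i$-th and $(i+1)$-th leaves. Set $\mathcal{P}(V)=\bigoplus_{n\ge0}\mathbf{k}\mathcal{D}_n\otimes V^{\otimes n}$, $\overline{\mathcal{P}(V)}=\bigoplus_{n\ge1}\mathbf{k}\mathcal{D}_n\otimes V^{\otimes n}$; $T\otimes(v_1\otimes\cdots\otimes v_n)$ is identified with the tree $(T;v_1,\dots,v_n)$ whose $i$-th angle is decorated by $v_i$. Each decorated tree $T\ne|$ is uniquely $T_0\vee_{v_1}\cdots\vee_{v_k}T_k$ ($k\ge1$): the root vertex has branches $T_0,\dots,T_k$ from left to right with the angles at the root vertex decorated by $v_1,\dots,v_k$. Write $T[v]=|\vee_v|$. The operations are defined recursively: for $T=T_0\vee_{v_1}\cdots\vee_{v_k}T_k$, $T'=T'_0\vee_{v_{k+1}}\cdots\vee_{v_{k+l}}T'_l$ ($k,l\ge1$), $$T\prec_\sigma T'=T_0\vee_{v_1}\cdots\vee_{v_k}(T_k*_\sigma T'),\quad T\succ_\sigma T'=(T*_\sigma T'_0)\vee_{v_{k+1}}\cdots\vee_{v_{k+l}}T'_l,$$ $$T\cdot_\sigma T'=T_0\vee_{v_1}\cdots\vee_{v_k}(T_k*_\sigma T'_0)\vee_{v_{k+1}}\cdots\vee_{v_{k+l}}T'_l,$$ where $*_\sigma=\prec_\sigma+\succ_\sigma+\cdot_\sigma$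 on $\overline{\mathcal{P}(V)}$, extended to $\mathcal{P}(V)$ with unit $|$. The braiding is $\sigma_{AT}((T;v_1,\dots,v_m)\otimes(T';v_{m+1},\dots,v_{m+n}))=(T'\otimes T)\beta_{mn}(v_1\otimes\cdots\otimes v_{m+n})$ ($T'$ decorated by the first $n$ resulting factors, $T$ by the last $m$). *)

(* Defs.v *)
From HB Require Import structures.
From mathcomp Require Import all_boot all_algebra.
From mathcomp Require Import boolp classical_sets functions cardinality fsbigop.
From mathcomp Require Import generic_quotient finmap zify.

Set Implicit Arguments.
Unset Strict Implicit.
Unset Printing Implicit Defensive.

Import GRing.Theory.
Local Open Scope classical_set_scope.
Local Open Scope quotient_scope.
Local Open Scope ring_scope.

Definition is_bilinear (k : fieldType) (U W M : lmodType k) (f : U -> W -> M) : Prop :=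
  bilinear_for *:%R *:%R f.

Lemma lin0 (k : fieldType) (U M : lmodType k) (f : U -> M) :
  linear f -> f 0 = 0.
Proof. by move=> fl; have := fl (-1) 0 0; rewrite scaler0 addr0 scaleN1r addNr. Qed.

Lemma linD (k : fieldType) (U M : lmodType k) (f : U -> M) :
  linear f -> {morph f : x y / x + y}.
Proof. by move=> fl x y; have := fl 1 x y; rewrite !scale1r. Qed.

Lemma linZ (k : fieldType) (U M : lmodType k) (f : U -> M) :
  linear f -> forall a, {morph f : x / a *: x}.
Proof. by move=> fl a x; have := fl a x 0; rewrite !addr0 (lin0 fl) addr0. Qed.

Section Tensor.
Variables (k : fieldType) (U W : lmodType k).

(* A list [:: (u_1, w_1); ..; (u_n, w_n)] stands for the formal sum of the
   u_i (x) w_i; scalars are absorbed by the first factor. *)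
Inductive tens_eq : seq (U * W) -> seq (U * W) -> Prop :=
| tens_refl s : tens_eq s s
| tens_sym s t : tens_eq s t -> tens_eq t s
| tens_trans s t r : tens_eq s t -> tens_eq t r -> tens_eq s r
| tens_cat s1 s2 t1 t2 :
    tens_eq s1 t1 -> tens_eq s2 t2 -> tens_eq (s1 ++ s2) (t1 ++ t2)
| tens_catC s t : tens_eq (s ++ t) (t ++ s)
| tens_0 w : tens_eq [:: (0, w)] [::]
| tens_Dl u u' w : tens_eq [:: (u + u', w)] [:: (u, w); (u', w)]
| tens_Dr u w w' : tens_eq [:: (u, w + w')] [:: (u, w); (u, w')]
| tens_Z a u w : tens_eq [:: (a *: u, w)] [:: (u, a *: w)].

Definition tens_eqb (s t : seq (U * W)) : bool := `[< tens_eq s t >].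

Lemma tens_eqb_refl : reflexive tens_eqb.
Proof. by move=> s; apply/asboolP/tens_refl. Qed.

Lemma tens_eqb_sym : symmetric tens_eqb.
Proof. by move=> s t; apply/asboolP/asboolP; exact: tens_sym. Qed.

Lemma tens_eqb_trans : transitive tens_eqb.
Proof.
by move=> t s r /asboolP st /asboolP tr; apply/asboolP; apply: tens_trans tr.
Qed.

Canonical tens_equiv :=
  EquivRel tens_eqb tens_eqb_refl tens_eqb_sym tens_eqb_trans.

(* The wrapper keeps the module structure below from being attached to
   every quotient type. *)
Record tens : Type := Tens { tens_class : {eq_quot tens_equiv} }.

HB.instance Definition _ := gen_eqMixin tens.
HB.instance Definition _ := gen_choiceMixin tens.

Definition tpi (s : seq (U * W)) : tens := Tens (\pi s).
Definition trepr (x : tens) : seq (U * W) := repr (tens_class x).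

Lemma tpiP s t : tens_eq s t -> tpi s = tpi t.
Proof. by move=> st; congr Tens; apply/eqquotP/asboolP. Qed.

Lemma tpi_eq s t : tpi s = tpi t -> tens_eq s t.
Proof. by case=> /eqquotP/asboolP. Qed.

Lemma tpi_repr x : tpi (trepr x) = x.
Proof. by case: x => x; congr Tens; exact: reprK. Qed.

Lemma repr_tpi s : tens_eq (trepr (tpi s)) s.
Proof. by apply: tpi_eq; rewrite tpi_repr. Qed.

Definition fscale (a : k) (s : seq (U * W)) := [seq (a *: p.1, p.2) | p <- s].

Lemma fscale_eq a s t : tens_eq s t -> tens_eq (fscale a s) (fscale a t).
Proof.
elim=> {s t}.
- by move=> s; exact: tens_refl.
- by move=> s t _; exact: tens_sym.
- by move=> s t r _ st _; exact: tens_trans.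
- by move=> s1 s2 t1 t2 _ h1 _ h2; rewrite /fscale !map_cat; exact: tens_cat.
- by move=> s t; rewrite /fscale !map_cat; exact: tens_catC.
- by move=> w /=; rewrite scaler0; exact: tens_0.
- by move=> u u' w /=; rewrite scalerDr; exact: tens_Dl.
- by move=> u w w' /=; exact: tens_Dr.
- by move=> b u w /=; rewrite scalerA mulrC -scalerA; exact: tens_Z.
Qed.

Definition tadd (x y : tens) := tpi (trepr x ++ trepr y).
Definition tscale (a : k) (x : tens) := tpi (fscale a (trepr x)).

Lemma tadd_pi s t : tadd (tpi s) (tpi t) = tpi (s ++ t).
Proof. by apply: tpiP; apply: tens_cat; exact: repr_tpi. Qed.

Lemma tscale_pi a s : tscale a (tpi s) = tpi (fscale a s).
Proof. by apply: tpiP; apply: fscale_eq; exact: repr_tpi. Qed.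

Lemma taddA : associative tadd.
Proof.
move=> x y z; rewrite -[x]tpi_repr -[y]tpi_repr -[z]tpi_repr.
by rewrite !tadd_pi catA.
Qed.

Lemma taddC : commutative tadd.
Proof. by move=> x y; apply: tpiP; exact: tens_catC. Qed.

Lemma tadd0 : left_id (tpi [::]) tadd.
Proof. by move=> x; rewrite -[x]tpi_repr tadd_pi. Qed.

Lemma fscale_add a b s : tens_eq (fscale (a + b) s) (fscale a s ++ fscale b s).
Proof.
elim: s => [|[u w] s IH] /=; first exact: tens_refl.
rewrite scalerDl -cat1s.
apply: tens_trans (tens_cat (tens_Dl _ _ _) IH) _.
change (tens_eq
  ([:: (a *: u, w)] ++ ([:: (b *: u, w)] ++ (fscale a s ++ fscale b s)))
  ([:: (a *: u, w)] ++ (fscale a s ++ ([:: (b *: u, w)] ++ fscale b s)))).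
apply: tens_cat; first exact: tens_refl.
rewrite !catA; apply: tens_cat; [exact: tens_catC | exact: tens_refl].
Qed.

Lemma fscale0 s : tens_eq (fscale 0 s) [::].
Proof.
elim: s => [|[u w] s IH] /=; first exact: tens_refl.
rewrite scale0r -cat1s -[X in tens_eq _ X]cats0.
by apply: tens_cat => //; exact: tens_0.
Qed.

Lemma tscaleDl x : {morph tscale^~ x : a b / a + b >-> tadd a b}.
Proof.
by move=> a b; rewrite -[x]tpi_repr !tscale_pi tadd_pi; apply: tpiP; exact: fscale_add.
Qed.

Lemma tscale1 : left_id 1 tscale.
Proof.
move=> x; rewrite -[RHS]tpi_repr /tscale; congr tpi.
by rewrite /fscale -[RHS]map_id; apply: eq_map => -[u w] /=; rewrite scale1r.
Qed.

Lemma taddN : left_inverse (tpi [::]) (tscale (-1)) tadd.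
Proof.
move=> x; rewrite -[X in tadd _ X]tscale1 -tscaleDl addNr.
by rewrite -[x]tpi_repr tscale_pi; apply: tpiP; exact: fscale0.
Qed.

HB.instance Definition _ :=
  GRing.isZmodule.Build tens taddA taddC tadd0 taddN.

Lemma tscaleA a b x : tscale a (tscale b x) = tscale (a * b) x.
Proof.
rewrite -[x]tpi_repr !tscale_pi; congr tpi.
by rewrite /fscale -map_comp; apply: eq_map => -[u w] /=; rewrite scalerA.
Qed.

Lemma tscaleDr : right_distributive tscale +%R.
Proof.
move=> a x y; rewrite -[x]tpi_repr -[y]tpi_repr.
by rewrite /GRing.add /= tadd_pi !tscale_pi tadd_pi /fscale map_cat.
Qed.

HB.instance Definition _ :=
  GRing.Zmodule_isLmodule.Build k tens tscaleA tscale1 tscaleDr tscaleDl.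

Definition tensor (u : U) (w : W) : tens := tpi [:: (u, w)].

Definition fsum (M : lmodType k) (f : U -> W -> M) (s : seq (U * W)) : M :=
  \sum_(p <- s) f p.1 p.2.

(* The linear map induced by f when f is bilinear (junk otherwise). *)
Definition tens_lift (M : lmodType k) (f : U -> W -> M) (x : tens) : M :=
  fsum f (trepr x).

Lemma fsum_eq (M : lmodType k) (f : U -> W -> M) s t :
  is_bilinear f -> tens_eq s t -> fsum f s = fsum f t.
Proof.
move=> [fl fr]; rewrite /fsum; elim=> {s t} //=.
- by move=> s t r _ -> _ ->.
- by move=> s1 s2 t1 t2 _ h1 _ h2; rewrite !big_cat /= h1 h2.
- by move=> s t; rewrite !big_cat /= addrC.
- by move=> w; rewrite big_seq1 big_nil /= (lin0 (fl w)).
- by move=> u u' w; rewrite !big_cons !big_nil /= !addr0 (linD (fl w)).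
- by move=> u w w'; rewrite !big_cons !big_nil /= !addr0 (linD (fr u)).
- by move=> a u w; rewrite !big_seq1 /= (linZ (fl w)) (linZ (fr u)).
Qed.

Lemma tensor_bilinear : is_bilinear tensor.
Proof.
split=> [w a u u' | u a w w'] /=.
- rewrite /tensor -[a *: tpi _]/(tscale a _) tscale_pi [RHS]tadd_pi /=.
  by apply: tpiP; exact: tens_Dl.
- rewrite /tensor -[a *: tpi _]/(tscale a _) tscale_pi [RHS]tadd_pi /=.
  apply: tpiP; apply: tens_trans (tens_Dr _ _ _) _.
  rewrite -cat1s -[X in tens_eq _ X]cat1s.
  by apply: tens_cat; [apply/tens_sym/tens_Z | exact: tens_refl].
Qed.

Lemma tens_lift_linear (M : lmodType k) (f : U -> W -> M) :
  is_bilinear f -> linear (tens_lift f).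
Proof.
move=> fb a x y; rewrite -[x]tpi_repr -[y]tpi_repr.
rewrite -[a *: tpi _]/(tscale a _) tscale_pi.
rewrite -[tpi _ + _]/(tadd _ _) tadd_pi /tens_lift.
rewrite !(fsum_eq fb (repr_tpi _)) /fsum big_cat /= big_map scaler_sumr.
congr (_ + _); apply: eq_bigr => -[u w] _ /=; case: fb => fl _.
by rewrite (linZ (fl w)).
Qed.

Lemma tens_liftE (M : lmodType k) (f : U -> W -> M) u w :
  is_bilinear f -> tens_lift f (tensor u w) = f u w.
Proof.
by move=> fb; rewrite /tens_lift (fsum_eq fb (repr_tpi _)) /fsum big_seq1.
Qed.

Lemma tens_decomp (x : tens) : exists s, x = \sum_(p <- s) tensor p.1 p.2.
Proof.
exists (trepr x); rewrite -[LHS]tpi_repr; elim: (trepr x) => [|[u w] s IH].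
  by rewrite big_nil.
by rewrite big_cons -IH [RHS]tadd_pi.
Qed.

Lemma tens_lift_unique (M : lmodType k) (g h : tens -> M) :
  linear g -> linear h -> (forall u w, g (tensor u w) = h (tensor u w)) ->
  g =1 h.
Proof.
move=> gl hl gh x; have [s ->] := tens_decomp x.
elim: s => [|p s IH]; first by rewrite big_nil (lin0 gl) (lin0 hl).
by rewrite big_cons (linD gl) (linD hl) gh IH.
Qed.

End Tensor.

Notation "u ⊗ w" := (tensor u w) (at level 40, left associativity) : ring_scope.

Section DirectSum.
Variables (k : fieldType) (I : choiceType) (M : I -> lmodType k).

Record dsum : Type := DSum {
  dsum_fun :> forall i, M i;
  dsum_finite : finite_set [set i | dsum_fun i != 0] }.

HB.instance Definition _ := gen_eqMixin dsum.
HB.instance Definition _ := gen_choiceMixin dsum.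

Lemma dsumP (f g : dsum) : (forall i, f i = g i) -> f = g.
Proof.
case: f => f fF; case: g => g gF /= fg.
have {}fg : f = g by apply: functional_extensionality_dep.
by case: g / fg gF => gF; congr DSum; exact: Prop_irrelevance.
Qed.

Fact dsum0_finite : finite_set [set i | (fun i => 0 : M i) i != 0].
Proof.
by rewrite (_ : [set _ | _] = set0) //; apply/seteqP; split=> i //=; rewrite eqxx.
Qed.

Fact dsumD_finite (f g : dsum) :
  finite_set [set i | (fun i => f i + g i) i != 0].
Proof.
have : finite_set ([set i | f i != 0] `|` [set i | g i != 0]).
  by rewrite finite_setU; split; exact: dsum_finite.
apply: sub_finite_set => i /=.
by case: (eqVneq (f i) 0) => [->|]; [rewrite add0r; right | left].
Qed.

Fact dsumZ_finite (a : k) (f : dsum) :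
  finite_set [set i | (fun i => a *: f i) i != 0].
Proof.
apply: sub_finite_set (dsum_finite f) => i /=.
by apply: contra => /eqP ->; rewrite scaler0.
Qed.

Definition dsum0 := DSum dsum0_finite.
Definition dsumD f g := DSum (dsumD_finite f g).
Definition dsumZ a f := DSum (dsumZ_finite a f).

Fact dsumDA : associative dsumD.
Proof. by move=> f g h; apply: dsumP => i /=; rewrite addrA. Qed.

Fact dsumDC : commutative dsumD.
Proof. by move=> f g; apply: dsumP => i /=; rewrite addrC. Qed.

Fact dsum0D : left_id dsum0 dsumD.
Proof. by move=> f; apply: dsumP => i /=; rewrite add0r. Qed.

Fact dsumND : left_inverse dsum0 (dsumZ (-1)) dsumD.
Proof. by move=> f; apply: dsumP => i /=; rewrite scaleN1r addNr. Qed.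

HB.instance Definition _ :=
  GRing.isZmodule.Build dsum dsumDA dsumDC dsum0D dsumND.

Fact dsumZA a b f : dsumZ a (dsumZ b f) = dsumZ (a * b) f.
Proof. by apply: dsumP => i /=; rewrite scalerA. Qed.

Fact dsum1Z : left_id 1 dsumZ.
Proof. by move=> f; apply: dsumP => i /=; rewrite scale1r. Qed.

Fact dsumZDr : right_distributive dsumZ +%R.
Proof. by move=> a f g; apply: dsumP => i /=; rewrite scalerDr. Qed.

Fact dsumZDl f : {morph dsumZ^~ f : a b / a + b >-> a + b}.
Proof. by move=> a b; apply: dsumP => i /=; rewrite scalerDl. Qed.

HB.instance Definition _ :=
  GRing.Zmodule_isLmodule.Build k dsum dsumZA dsum1Z dsumZDr dsumZDl.

Definition dsum_in_fun (i : I) (x : M i) (j : I) : M j :=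
  if @eqP _ i j is ReflectT e then ecast j (M j) e x else 0.

Fact dsum_in_finite i x : finite_set [set j | @dsum_in_fun i x j != 0].
Proof.
apply: (@sub_finite_set _ _ [set i]) => // j /=; rewrite /dsum_in_fun.
by case: eqP => [e _|_ /eqP //]; exact: esym.
Qed.

Definition dsum_in i (x : M i) : dsum := DSum (dsum_in_finite x).

(* The map induced by the F i; the support of the sum is finite as soon as each
   F i is linear. *)
Definition dsum_lift (N : lmodType k) (F : forall i, M i -> N) (f : dsum) : N :=
  \sum_(i \in [set: I]) F i (f i).

Lemma dsum_lift_linear (N : lmodType k) (F : forall i, M i -> N) :
  (forall i, linear (F i)) -> linear (dsum_lift F).
Proof.
move=> Fl a f g; rewrite /dsum_lift.
have fin : finite_set ([set i | f i != 0] `|` [set i | g i != 0]).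
  by rewrite finite_setU; split; exact: dsum_finite.
have widen h : (forall i, f i = 0 -> g i = 0 -> h i = 0) ->
    \sum_(i \in [set: I]) F i (h i) =
    \sum_(i \in [set i | f i != 0] `|` [set i | g i != 0]) F i (h i).
  move=> h0; apply/esym/fsbig_widen => // i [_ /not_orP [/negP fi /negP gi]] /=.
  move: fi gi; rewrite !negbK => /eqP fi /eqP gi.
  by rewrite h0 // (lin0 (Fl i)).
rewrite (widen f) // (widen g) // (widen (a *: f + g)); last first.
  by move=> i fi gi; rewrite /= fi gi scaler0 addr0.
rewrite !fsbig_finite //= scaler_sumr -big_split /=.
by apply: eq_bigr => i _; rewrite Fl.
Qed.

Lemma dsum_inE i (x : M i) : dsum_in x i = x.
Proof.
rewrite /= /dsum_in_fun; case: eqP => [e|//].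
by rewrite (eq_axiomK e).
Qed.

Lemma dsum_inNE i j (x : M i) : i != j -> dsum_in x j = 0.
Proof. by rewrite /= /dsum_in_fun; case: eqP. Qed.

Lemma dsum_in_linear i : linear (@dsum_in i).
Proof.
move=> a x y; apply: dsumP => j.
change (dsum_in (a *: x + y) j = a *: dsum_in x j + dsum_in y j).
case: (eqVneq i j) => [<-|ij]; first by rewrite !dsum_inE.
by rewrite !dsum_inNE // scaler0 addr0.
Qed.

Lemma dsum_liftE (N : lmodType k) (F : forall i, M i -> N) i (x : M i) :
  (forall i, linear (F i)) -> dsum_lift F (dsum_in x) = F i x.
Proof.
move=> Fl; rewrite /dsum_lift -[in RHS](dsum_inE x).
rewrite -(fsbig_set1 +%R i (fun j => F j (dsum_in x j))).
apply/esym/fsbig_widen => // j [_ ji]; change (F j (dsum_in x j) = 0).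
by rewrite dsum_inNE ?(lin0 (Fl j)) //; apply/eqP => /esym.
Qed.

Lemma dsum_decomp (f : dsum) : exists s : seq I, f = \sum_(i <- s) dsum_in (f i).
Proof.
have /finite_fsetP[X fX] := dsum_finite f; exists X.
apply: dsumP => j.
rewrite (big_morph (fun h : dsum => h j) (id1 := 0) (op1 := +%R)) //.
have [jX|jX] := boolP (j \in X).
  rewrite (big_fsetD1 j) //= -[LHS]addr0 -[X in _ = X + _]/(dsum_in _ _) dsum_inE.
  congr (_ + _); rewrite big_seq big1 // => i; rewrite !inE => /andP[ij _].
  exact: dsum_inNE.
have -> : f j = 0.
  by apply/eqP; apply: contraNT jX => fj; have : [set` X] j by rewrite -fX.
rewrite big_seq big1 // => i iX; apply: dsum_inNE.
by apply: contraNneq jX => <-.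
Qed.

Lemma dsum_lift_unique (N : lmodType k) (g h : dsum -> N) :
  linear g -> linear h -> (forall i (x : M i), g (dsum_in x) = h (dsum_in x)) ->
  g =1 h.
Proof.
move=> gl hl gh f; have [s ->] := dsum_decomp f.
elim: s => [|i s IH]; first by rewrite big_nil (lin0 gl) (lin0 hl).
by rewrite big_cons (linD gl) (linD hl) gh IH.
Qed.

End DirectSum.

Arguments dsum_in {k I M} i x.

Section TensorMaps.
Variable k : fieldType.
Implicit Types U W X : lmodType k.

Definition tmap U U' W W' (f : U -> U') (g : W -> W') : tens U W -> tens U' W' :=
  tens_lift (fun u w => f u ⊗ g w).

Definition tassoc U W X : tens (tens U W) X -> tens U (tens W X) :=
  tens_lift (fun p x => tens_lift (fun u w => u ⊗ (w ⊗ x)) p).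

Definition tassocV U W X : tens U (tens W X) -> tens (tens U W) X :=
  tens_lift (fun u p => tens_lift (fun w x => u ⊗ w ⊗ x) p).

(* s (x) id, on the first two factors of U (x) (U (x) X) *)
Definition act12 U X (s : tens U U -> tens U U) (z : tens U (tens U X)) :
    tens U (tens U X) :=
  tassoc (tmap s id (tassocV z)).

End TensorMaps.

Section Braidings.
Variable k : fieldType.

Definition sigma1 (V : lmodType k) (s : tens V V -> tens V V) :
  tens V (tens V V) -> tens V (tens V V) := act12 s.

Definition sigma2 (V : lmodType k) (s : tens V V -> tens V V) :
  tens V (tens V V) -> tens V (tens V V) := tmap id s.

Definition is_braiding (V : lmodType k) (s : tens V V -> tens V V) : Prop :=
  linear s /\
  forall z, sigma1 s (sigma2 s (sigma1 s z)) = sigma2 s (sigma1 s (sigma2 s z)).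

Definition is_braided_hom (V V' : lmodType k) (s : tens V V -> tens V V)
    (s' : tens V' V' -> tens V' V') (f : V -> V') : Prop :=
  linear f /\ forall z, tmap f f (s z) = s' (tmap f f z).

End Braidings.

Section Tridendriform.
Variable k : fieldType.

Record is_tridendriform (R : lmodType k) (prec succ dot : R -> R -> R) : Prop := {
  td_precB : is_bilinear prec;
  td_succB : is_bilinear succ;
  td_dotB : is_bilinear dot;
  td_pp : forall x y z,
    prec (prec x y) z = prec x (prec y z + succ y z + dot y z);
  td_sp : forall x y z, prec (succ x y) z = succ x (prec y z);
  td_ss : forall x y z,
    succ x (succ y z) = succ (prec x y + succ x y + dot x y) z;
  td_dp : forall x y z, prec (dot x y) z = dot x (prec y z);
  td_pd : forall x y z, dot (prec x y) z = dot x (succ y z);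
  td_sd : forall x y z, dot (succ x y) z = succ x (dot y z);
  td_dd : forall x y z, dot (dot x y) z = dot x (dot y z) }.

Definition braiding_compat (R : lmodType k) (t : tens R R -> tens R R)
    (op : R -> R -> R) : Prop :=
  (forall z : tens R (tens R R),
     t (tmap id (tens_lift op) z) =
     tmap (tens_lift op) id (tassocV (sigma2 t (sigma1 t z)))) /\
  (forall z : tens R (tens R R),
     t (tmap (tens_lift op) id (tassocV z)) =
     tmap id (tens_lift op) (sigma1 t (sigma2 t z))).

Record is_braided_tridendriform (R : lmodType k) (prec succ dot : R -> R -> R)
    (t : tens R R -> tens R R) : Prop := {
  btd_tridendriform : is_tridendriform prec succ dot;
  btd_braiding : is_braiding t;
  btd_prec : braiding_compat t prec;
  btd_succ : braiding_compat t succ;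
  btd_dot : braiding_compat t dot }.

Record is_braided_tridendriform_hom (R R' : lmodType k)
    (prec succ dot : R -> R -> R) (t : tens R R -> tens R R)
    (prec' succ' dot' : R' -> R' -> R') (t' : tens R' R' -> tens R' R')
    (f : R -> R') : Prop := {
  bth_braided : is_braided_hom t t' f;
  bth_prec : {morph f : x y / prec x y >-> prec' x y};
  bth_succ : {morph f : x y / succ x y >-> succ' x y};
  bth_dot : {morph f : x y / dot x y >-> dot' x y} }.

End Tridendriform.

Section TensorPowers.
Variables (k : fieldType) (V : lmodType k).

Fixpoint tpow (n : nat) : lmodType k :=
  if n is m.+1 then tens V (tpow m) else k^o.

Fixpoint tcat (m n : nat) : tpow m -> tpow n -> tpow (m + n) :=
  match m return tpow m -> tpow n -> tpow (m + n) with
  | 0 => fun a y => (a : k) *: y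
  | m'.+1 => fun x y => tens_lift (fun v x' => v ⊗ tcat x' y) x
  end.

Fixpoint tsplit (m n : nat) : tpow (m + n) -> tens (tpow m) (tpow n) :=
  match m return tpow (m + n) -> tens (tpow m) (tpow n) with
  | 0 => fun z => (1 : k^o) ⊗ z
  | m'.+1 => tens_lift (fun v z => tassocV (v ⊗ tsplit z))
  end.

Variable s : tens V V -> tens V V.

(* s acting on the factors number i and i+1, counted from 0 (the identity if
   i+1 >= n). *)
Fixpoint sigma_at (i n : nat) : tpow n -> tpow n :=
  match n return tpow n -> tpow n with
  | 0 => id
  | m.+1 => if i is j.+1 then tmap id (@sigma_at j m)
            else match m return tpow m.+1 -> tpow m.+1 with
                 | 0 => id
                 | _.+1 => act12 s
                 end
  end.

(* s_{i_1} o ... o s_{i_l} for the word [:: i_1; ..; i_l]: the operator T_w when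
   the word is a reduced expression of the permutation w. *)
Definition sigma_word (w : seq nat) (n : nat) : tpow n -> tpow n :=
  foldr (fun i F => @sigma_at i n \o F) id w.

End TensorPowers.

(* The permutation chi_{mn}, on {0, .., m+n-1} instead of {1, .., m+n}. *)
Definition chi (m n a : nat) : nat :=
  if (a < m)%N then (n + a)%N else if (a < m + n)%N then (a - m)%N else a.

Definition adj_transp (i a : nat) : nat :=
  if a == i then i.+1 else if a == i.+1 then i else a.

Definition word_perm (w : seq nat) : nat -> nat :=
  foldr (fun i f => adj_transp i \o f) id w.

(* A reduced expression of chi_{mn}, see [chi_wordP]: the factor number m-1 goes
   past the last n factors, then the factor number m-2, and so on. *)
Definition chi_word (m n : nat) : seq nat :=
  flatten [seq rev (iota p n) | p <- iota 0 m].

Definition reduced_expr (n : nat) (f : nat -> nat) (w : seq nat) : Prop :=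
  [/\ all (fun i => i.+1 < n)%N w, word_perm w =1 f &
      forall w', all (fun i => i.+1 < n)%N w' -> word_perm w' =1 f ->
        (size w <= size w')%N].

Lemma rev_iota_perm p n a : word_perm (rev (iota p n)) a =
  if a == p then (p + n)%N else if (p < a <= p + n)%N then a.-1 else a.
Proof.
elim: n a => [|n IH] a; first by rewrite /=; do !case: ifP => ?; lia.
rewrite -addn1 iotaD rev_cat /= IH /adj_transp.
have [h1|h1] := boolP (a == p); last have [h2|h2] := boolP (p < a <= p + n)%N.
all: by do !case: ifP => ?; lia.
Qed.

Lemma word_perm_cat w1 w2 : word_perm (w1 ++ w2) =1 word_perm w1 \o word_perm w2.
Proof. by move=> a; elim: w1 => //= i w1 ->. Qed.

Lemma chi_word_perm m n : word_perm (chi_word m n) =1 chi m n.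
Proof.
suff H p a : word_perm (flatten [seq rev (iota q n) | q <- iota p m]) a =
    if (a < p)%N then a else (p + chi m n (a - p))%N.
  by move=> a; rewrite /chi_word H ltn0 subn0.
elim: m p a => [|m IH] p a; first by rewrite /= /chi; do !case: ifP => ?; lia.
rewrite /= word_perm_cat /= rev_iota_perm IH /chi.
case: (boolP (a < p.+1)%N) => h1; last case: (boolP (a - p.+1 < m)%N) => h2;
  last case: (boolP (a - p.+1 < m + n)%N) => h3.
all: by do !case: ifP => ?; lia.
Qed.

Lemma size_chi_word m n : size (chi_word m n) = (m * n)%N.
Proof.
rewrite /chi_word; elim: m 0%N => //= m IH p.
by rewrite size_cat size_rev size_iota IH mulSn.
Qed.

(* Composing with an adjacent transposition increases the total upward
   displacement by at most one. *)
Lemma word_perm_displacement N w :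
  (\sum_(0 <= a < N) (word_perm w a - a) <= size w)%N.
Proof.
elim: w => [|i w IH] /=.
  by rewrite big1 // => a _; rewrite subnn.
have wI : injective (word_perm w).
  elim: w {IH} => //= j w IH; apply: inj_comp IH.
  by move=> a b; rewrite /adj_transp; do !case: ifP => ?; lia.
have E : (\sum_(0 <= a < N) (word_perm w a == i) <= 1)%N.
  have [/hasP[a aN /eqP wa]|] := boolP (has (fun a => word_perm w a == i) (index_iota 0 N)).
    rewrite (bigD1_seq a) ?iota_uniq //= big1 ?addn0 ?leq_b1 // => b ba.
    case: eqP => // wb; case/eqP: ba; apply: wI; lia.
  move/hasPn => H; rewrite big_seq big1 // => a aN.
  by rewrite (negPf (H a aN)).
rewrite -addn1; apply: leq_trans (leq_add IH E).
rewrite -big_split /=; apply: leq_sum => a _; rewrite /adj_transp.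
by do !case: ifP => ?; lia.
Qed.

Lemma chi_wordP m n : reduced_expr (m + n) (chi m n) (chi_word m n).
Proof.
split.
- apply/allP => i /flatten_mapP[p]; rewrite mem_iota mem_rev mem_iota; lia.
- exact: chi_word_perm.
move=> w _ wE; rewrite size_chi_word.
apply: leq_trans (word_perm_displacement (m + n) w).
rewrite (@big_cat_nat _ _ _ m) //=; last by lia.
apply: leq_trans (leq_addr _ _).
rewrite (eq_big_nat _ _ (F2 := fun=> n)); last first.
  by move=> a am; rewrite wE /chi ifT; lia.
by rewrite sum_nat_const_nat; lia.
Qed.

Section Beta.
Variables (k : fieldType) (V : lmodType k) (s : tens V V -> tens V V).

Definition beta (m n : nat) (z : tens (tpow V m) (tpow V n)) :
    tens (tpow V n) (tpow V m) :=
  let z' := sigma_word s (chi_word m n) (tens_lift (@tcat k V m n) z) in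
  tsplit (ecast l (tpow V l) (addnC m n) z').

End Beta.

(* The tree T_0 \/_{v_1} T_1 \/_{v_2} .. \/_{v_k} T_k, with k >= 1, is
   Node T_0 v_1 (Cons T_1 v_2 (.. (Last T_k))). *)
Inductive tree (A : Type) : Type :=
| Leaf
| Node of tree A & A & branches A
with branches (A : Type) : Type :=
| Last of tree A
| Cons of tree A & A & branches A.
Arguments Leaf {A}.

Scheme tree_branches_ind := Induction for tree Sort Prop
  with branches_tree_ind := Induction for branches Sort Prop.
Combined Scheme tree_mutind from tree_branches_ind, branches_tree_ind.

HB.instance Definition _ (A : Type) := gen_eqMixin (tree A).
HB.instance Definition _ (A : Type) := gen_choiceMixin (tree A).
HB.instance Definition _ (A : Type) := gen_eqMixin (branches A).

Fixpoint leaves A (T : tree A) : nat :=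
  match T with Leaf => 1 | Node T0 _ B => leaves T0 + bleaves B end
with bleaves A (B : branches A) : nat :=
  match B with Last T => leaves T | Cons T _ C => leaves T + bleaves C end.

(* The decorations of the angles, from left to right. *)
Fixpoint decos A (T : tree A) : seq A :=
  match T with Leaf => [::] | Node T0 v B => decos T0 ++ v :: bdecos B end
with bdecos A (B : branches A) : seq A :=
  match B with Last T => decos T | Cons T v C => decos T ++ v :: bdecos C end.

Fixpoint tree_map A A' (f : A -> A') (T : tree A) : tree A' :=
  match T with
  | Leaf => Leaf
  | Node T0 v B => Node (tree_map f T0) (f v) (branches_map f B)
  end
with branches_map A A' (f : A -> A') (B : branches A) : branches A' :=
  match B with
  | Last T => Last (tree_map f T)
  | Cons T v C => Cons (tree_map f T) (f v) (branches_map f C)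
  end.

(* B = T_1 \/ .. \/ T_k continued by \/_v B' *)
Fixpoint bcat A (B : branches A) (v : A) (B' : branches A) : branches A :=
  match B with
  | Last T => Cons T v B'
  | Cons T w C => Cons T w (bcat C v B')
  end.

(* Every product of two decorated trees is a sum of decorated trees with
   coefficients 1, represented by the list of its terms.  [star] is the product
   * with unit Leaf, and [bstar B T'] lists the T_1 \/ .. \/ (T_k * T'). *)
Fixpoint star A (T : tree A) : tree A -> seq (tree A) :=
  match T with
  | Leaf => fun T' => [:: T']
  | Node T0 v B =>
      fix starT (T' : tree A) : seq (tree A) :=
        match T' with
        | Leaf => [:: T]
        | Node T0' v' B' =>
            [seq Node T0 v C | C <- bstar B T']
            ++ [seq Node U v' B' | U <- starT T0']
            ++ [seq Node T0 v (bcat C v' B') | C <- bstar B T0']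
        end
  end
with bstar A (B : branches A) (T' : tree A) : seq (branches A) :=
  match B with
  | Last T => [seq Last U | U <- star T T']
  | Cons T v C => [seq Cons T v D | D <- bstar C T']
  end.

(* The three products of two trees different from Leaf (the value on Leaf is
   irrelevant). *)
Definition tree_prec A (T T' : tree A) : seq (tree A) :=
  if T is Node T0 v B then [seq Node T0 v C | C <- bstar B T'] else [::].

Definition tree_succ A (T T' : tree A) : seq (tree A) :=
  if T' is Node T0' v' B' then [seq Node U v' B' | U <- star T T0'] else [::].

Definition tree_dot A (T T' : tree A) : seq (tree A) :=
  match T, T' with
  | Node T0 v B, Node T0' v' B' =>
      [seq Node T0 v (bcat C v' B') | C <- bstar B T0']
  | _, _ => [::]
  end.

Lemma starE A (T T' : tree A) : T <> Leaf -> T' <> Leaf ->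
  star T T' = tree_prec T T' ++ tree_succ T T' ++ tree_dot T T'.
Proof. by case: T => // T0 v B _; case: T'. Qed.

Lemma star0T A (T : tree A) : star Leaf T = [:: T].
Proof. by []. Qed.

Lemma starT0 A (T : tree A) : star T Leaf = [:: T].
Proof. by case: T. Qed.

(* Undecorated trees are trees decorated by elements of unit. *)
Definition treeD (n : nat) : choiceType := {T : tree unit | leaves T == n.+1}.

Section DecoratedTrees.
Variables (k : fieldType) (V : lmodType k).

Definition kD (n : nat) : lmodType k := dsum (fun _ : treeD n => k^o).

Definition kD_basis (n : nat) (T : tree unit) : kD n :=
  if insub T is Some T' then dsum_in (T' : treeD n) (1 : k^o) else 0.

Definition PV (n : nat) : lmodType k := tens (kD n) (tpow V n).

(* The summand of degree n >= 1 has index n-1. *)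
Definition Pbar : lmodType k := dsum (fun n => PV n.+1).

Fixpoint tpure (v : seq V) : tpow V (size v) :=
  if v is x :: v' then x ⊗ tpure v' else (1 : k^o).

(* (T; v_1, .., v_n) as an element of the sum, for T different from Leaf. *)
Definition dtree (T : tree V) : Pbar :=
  if decos T is v :: w then
    dsum_in (size w)
      (kD_basis (size w).+1 (tree_map (fun=> tt) T) ⊗ tpure (v :: w))
  else 0.

Definition i_V (v : V) : Pbar := dtree (Node Leaf v (Last Leaf)).

Section Products.
Variable op : tree unit -> tree unit -> seq (tree unit).

Definition kD_op (m n : nat) (a : kD m) (b : kD n) : kD (m + n) :=
  dsum_lift (fun (T : treeD m) (x : k^o) => dsum_lift (fun (T' : treeD n) (y : k^o) =>
    ((x : k) * (y : k)) *: \sum_(U <- op (val T) (val T')) kD_basis (m + n) U)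
  b) a.

Definition PV_op (m n : nat) (p : PV m) (q : PV n) : PV (m + n) :=
  tens_lift (fun a x => tens_lift (fun b y => kD_op a b ⊗ tcat x y) q) p.

Definition Pbar_op (f g : Pbar) : Pbar :=
  dsum_lift (fun m (p : PV m.+1) => dsum_lift (fun n (q : PV n.+1) =>
    dsum_in (m + n.+1)%N (PV_op p q)) g) f.

End Products.

Definition Pbar_prec := Pbar_op (@tree_prec unit).
Definition Pbar_succ := Pbar_op (@tree_succ unit).
Definition Pbar_dot := Pbar_op (@tree_dot unit).

Variable s : tens V V -> tens V V.

Definition sigmaAT : tens Pbar Pbar -> tens Pbar Pbar :=
  tens_lift (fun f g =>
    dsum_lift (fun m (p : PV m.+1) => dsum_lift (fun n (q : PV n.+1) =>
      tens_lift (fun t x => tens_lift (fun t' x' =>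
        tens_lift (fun y' y => dsum_in n (t' ⊗ y') ⊗ dsum_in m (t ⊗ y))
          (beta s (x ⊗ x'))) q) p) g) f).

End DecoratedTrees.

Section MultilinearLifts.
Variable k : fieldType.

Lemma tens_lift_linf (U W N : lmodType k) (f g : U -> W -> N) a x :
  is_bilinear f -> is_bilinear g ->
  tens_lift (fun u w => a *: f u w + g u w) x = a *: tens_lift f x + tens_lift g x.
Proof.
move=> fb gb.
have hb : is_bilinear (fun u w => a *: f u w + g u w).
  case: fb gb => fl fr [gl gr]; split=> [w b u u'|u b w w'] /=.
    by rewrite (fl w) (gl w) !scalerDr !scalerA addrACA mulrC.
  by rewrite (fr u) (gr u) !scalerDr !scalerA addrACA mulrC.
move: x; apply: tens_lift_unique.
- exact: tens_lift_linear.
- move=> b y z /=; rewrite !tens_lift_linear // !scalerDr !scalerA.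
  by rewrite addrACA mulrC.
- by move=> u w; rewrite !tens_liftE.
Qed.

Lemma tens_lift2_bilinear (U W U' W' N : lmodType k)
    (F : U -> W -> U' -> W' -> N) :
  (forall u' w', is_bilinear (fun u w => F u w u' w')) ->
  (forall u w, is_bilinear (F u w)) ->
  is_bilinear (fun p q => tens_lift (fun u w => tens_lift (F u w) q) p).
Proof.
move=> F1 F2.
have E q : is_bilinear (fun u w => tens_lift (F u w) q).
  split=> [w a u u'|u a w w'] /=; rewrite -tens_lift_linf //;
    congr tens_lift; apply/funext => x; apply/funext => y.
  - exact: (F1 x y).1.
  - exact: (F1 x y).2.
split=> [q|p] /=; first exact: tens_lift_linear.
move=> a x y; rewrite -tens_lift_linf //.
congr tens_lift; apply/funext => u; apply/funext => w.
exact: tens_lift_linear.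
Qed.

Lemma dsum_lift_linf (I : choiceType) (M : I -> lmodType k) (N : lmodType k)
    (F G : forall i, M i -> N) a x :
  (forall i, linear (F i)) -> (forall i, linear (G i)) ->
  dsum_lift (fun i y => a *: F i y + G i y) x = a *: dsum_lift F x + dsum_lift G x.
Proof.
move=> Fl Gl.
have Hl i : linear (fun y => a *: F i y + G i y).
  move=> b y z /=.
  by rewrite (Fl i) (Gl i) !scalerDr !scalerA addrACA mulrC.
move: x; apply: dsum_lift_unique.
- exact: dsum_lift_linear.
- move=> b y z /=; rewrite !dsum_lift_linear // !scalerDr !scalerA.
  by rewrite addrACA mulrC.
- by move=> i y; rewrite !dsum_liftE.
Qed.

Lemma dsum_lift2_bilinear (I J : choiceType) (M : I -> lmodType k)
    (M' : J -> lmodType k) (N : lmodType k) (F : forall i j, M i -> M' j -> N) :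
  (forall i j, is_bilinear (F i j)) ->
  is_bilinear (fun f g => dsum_lift (fun i x => dsum_lift (fun j => F i j x) g) f).
Proof.
move=> Fb.
have E g i : linear (fun x => dsum_lift (fun j => F i j x) g).
  move=> a x y /=; rewrite -dsum_lift_linf; try by move=> j; exact: (Fb i j).2.
  by congr dsum_lift; apply: functional_extensionality_dep => j; apply/funext => z;
     exact: (Fb i j).1.
split=> [g|f] /=; first exact: dsum_lift_linear.
move=> a x y; rewrite -dsum_lift_linf //.
congr dsum_lift; apply: functional_extensionality_dep => i; apply/funext => z.
by apply: dsum_lift_linear => j; exact: (Fb i j).2.
Qed.

End MultilinearLifts.

Section DecoratedProducts.
Variables (k : fieldType) (V : lmodType k).

Lemma tcat_bilinear m n : is_bilinear (@tcat k V m n).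
Proof.
elim: m => [|m [IHl IHr]].
  split=> [y a x x'|x a y y'] /=; first by rewrite scalerDl scalerA.
  by rewrite scalerDr !scalerA [x * a]mulrC.
have [tl tr] := @tensor_bilinear k V (tpow V (m + n)).
have E (y : tpow V n) : is_bilinear (fun (v : V) (x' : tpow V m) => v ⊗ tcat x' y).
  split=> [x' a v v' | v a x x'] /=; first by rewrite (tl (tcat x' y)).
  by rewrite (IHl y) (tr v).
split=> [y|x] /=; first exact: tens_lift_linear.
move=> a y y' /=; rewrite -tens_lift_linf //.
congr tens_lift; apply/funext => v; apply/funext => x'.
by rewrite (IHr x') (tr v).
Qed.

Section Op.
Variable op : tree unit -> tree unit -> seq (tree unit).

Lemma kD_op_bilinear m n : is_bilinear (@kD_op k op m n).
Proof.
apply: (@dsum_lift2_bilinear _ _ _ (fun=> k^o) (fun=> k^o)) => T T'.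
split=> [y a x x'|x a y y'] /=.
  by rewrite -[a *: x]/((a : k) * x) mulrDl scalerDl -mulrA -(scalerA a).
by rewrite -[a *: y]/((a : k) * y) mulrDr scalerDl mulrCA -(scalerA a).
Qed.

Lemma kD_basisE n T : leaves T == n.+1 ->
  exists2 X : treeD n, val X = T & kD_basis k n T = dsum_in X (1 : k^o).
Proof.
by move=> hT; rewrite /kD_basis; case: insubP => [X _ XT|/negP[] //]; exists X.
Qed.

Lemma kD_opE m n T T' : leaves T == m.+1 -> leaves T' == n.+1 ->
  kD_op op (kD_basis k m T) (kD_basis k n T') =
  \sum_(U <- op T T') kD_basis k (m + n) U.
Proof.
move=> /kD_basisE[X XT ->] /kD_basisE[X' XT' ->]; rewrite /kD_op.
have B2 Y Y' : is_bilinear (fun x y : k^o =>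
    ((x : k) * (y : k)) *: \sum_(U <- op (val (Y : treeD m)) (val (Y' : treeD n))) kD_basis k (m + n) U).
  split=> [y a x x'|x a y y'] /=.
    by rewrite -[a *: x]/((a : k) * x) mulrDl scalerDl -mulrA -(scalerA a).
  by rewrite -[a *: y]/((a : k) * y) mulrDr scalerDl mulrCA -(scalerA a).
rewrite (@dsum_liftE _ _ (fun=> k^o)); last first.
  move=> Y a x x' /=; rewrite -dsum_lift_linf; try by move=> j; exact: (B2 Y j).2.
  by congr dsum_lift; apply: functional_extensionality_dep => j; apply/funext => z;
     exact: (B2 Y j).1.
rewrite (@dsum_liftE _ _ (fun=> k^o)); last by move=> Y'; exact: (B2 X Y').2.
by rewrite mul1r scale1r XT XT'.
Qed.

Lemma PV_op_bilin4 m n :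
  (forall (b : kD k n) (y : tpow V n),
     is_bilinear (fun (a : kD k m) (x : tpow V m) => kD_op op a b ⊗ tcat x y)) /\
  (forall (a : kD k m) (x : tpow V m),
     is_bilinear (fun (b : kD k n) (y : tpow V n) => kD_op op a b ⊗ tcat x y)).
Proof.
have [Kl Kr] := kD_op_bilinear m n; have [Tl Tr] := tcat_bilinear m n.
have [tl tr] := @tensor_bilinear k (kD k (m + n)) (tpow V (m + n)).
split=> [b y|a x]; split=> [u c z z'|u c z z'] /=.
- by rewrite (Kl b) (tl (tcat u y)).
- by rewrite (Tl y) (tr (kD_op op u b)).
- by rewrite (Kr a) (tl (tcat x u)).
- by rewrite (Tr x) (tr (kD_op op a u)).
Qed.

Lemma PV_op_bilinear m n : is_bilinear (@PV_op k V op m n).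
Proof.
by have [h1 h2] := PV_op_bilin4 m n; apply: tens_lift2_bilinear.
Qed.

Lemma PV_opE m n (a : kD k m) (x : tpow V m) (b : kD k n) (y : tpow V n) :
  PV_op op (a ⊗ x) (b ⊗ y) = kD_op op a b ⊗ tcat x y.
Proof.
have [h1 h2] := PV_op_bilin4 m n; rewrite /PV_op tens_liftE ?tens_liftE //.
by split=> [w c u u'|u c w w'] /=; rewrite !tens_liftE //;
  [exact: (h1 b y).1 | exact: (h1 b y).2].
Qed.

Lemma Pbar_op_bilinear : is_bilinear (@Pbar_op k V op).
Proof.
apply: dsum_lift2_bilinear => m n; have [h1 h2] := PV_op_bilinear m.+1 n.+1.
split=> [q a p p'|p a q q'] /=.
  by rewrite (h1 q) dsum_in_linear.
by rewrite (h2 p) dsum_in_linear.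
Qed.

Lemma Pbar_opE m n (p : PV V m.+1) (q : PV V n.+1) :
  Pbar_op op (dsum_in m p) (dsum_in n q) = dsum_in (m + n.+1)%N (PV_op op p q).
Proof.
have h i j : is_bilinear (fun (x : PV V i.+1) (y : PV V j.+1) =>
    dsum_in (i + j.+1)%N (PV_op op x y) : Pbar V).
  have [h1 h2] := PV_op_bilinear i.+1 j.+1.
  split=> [y a x x'|x a y y'] /=.
    by rewrite (h1 y) dsum_in_linear.
  by rewrite (h2 x) dsum_in_linear.
rewrite /Pbar_op dsum_liftE; last first.
  move=> i a x x' /=; rewrite -dsum_lift_linf; try by move=> j; exact: (h i j).2.
  by congr dsum_lift; apply: functional_extensionality_dep => j; apply/funext => z;
     exact: (h i j).1.
by rewrite dsum_liftE // => j; exact: (h m j).2.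
Qed.

End Op.

Lemma decos_map A A' (f : A -> A') :
  (forall T, decos (tree_map f T) = map f (decos T)) /\
  (forall B, bdecos (branches_map f B) = map f (bdecos B)).
Proof.
apply: tree_mutind => //= [T IH v B IB|T IH v C IC];
  by rewrite IH map_cat /= ?IB ?IC.
Qed.

Lemma leaves_decos A :
  (forall T : tree A, leaves T = (size (decos T)).+1) /\
  (forall B : branches A, bleaves B = (size (bdecos B)).+1).
Proof.
apply: tree_mutind => //= [T IH v B IB|T IH v C IC];
  by rewrite IH ?IB ?IC size_cat /= addSn.
Qed.

Lemma bdecos_bcat A (B : branches A) v B' :
  bdecos (bcat B v B') = bdecos B ++ v :: bdecos B'.
Proof. by elim: B => //= T w C ->; rewrite -catA. Qed.

Lemma mem_star_decos A :
  (forall T T' U : tree A, U \in star T T' -> decos U = decos T ++ decos T') /\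
  (forall (B : branches A) T' C, C \in bstar B T' ->
     bdecos C = bdecos B ++ decos T').
Proof.
apply: tree_mutind => [T' U|T0 _ v B IB|T IT T' C|T _ v C IC T' D0] /=.
- by rewrite inE => /eqP ->.
- elim=> [|T0' IT' v' B'] U; first by rewrite inE cats0 => /eqP ->.
  rewrite !mem_cat => /or3P[] /mapP[C] CB -> /=.
  + by rewrite (IB _ _ CB) -!catA.
  + by rewrite (IT' _ CB) /= -!catA.
  + by rewrite bdecos_bcat (IB _ _ CB) -!catA.
- by move=> /mapP[U UT ->] /=; exact: IT.
- by move=> /mapP[C' CC ->] /=; rewrite (IC _ _ CC) -!catA.
Qed.

Lemma branches_map_bcat A A' (f : A -> A') B v B' :
  branches_map f (bcat B v B') = bcat (branches_map f B) (f v) (branches_map f B').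
Proof. by elim: B => //= T w C ->. Qed.

Lemma star_map A A' (f : A -> A') :
  (forall T T', star (tree_map f T) (tree_map f T') = map (tree_map f) (star T T')) /\
  (forall B T', bstar (branches_map f B) (tree_map f T') =
     map (branches_map f) (bstar B T')).
Proof.
have starN X (T0 : tree X) v B T0' v' B' :
    star (Node T0 v B) (Node T0' v' B') =
    [seq Node T0 v C | C <- bstar B (Node T0' v' B')]
    ++ [seq Node U v' B' | U <- star (Node T0 v B) T0']
    ++ [seq Node T0 v (bcat C v' B') | C <- bstar B T0'] by [].
apply: tree_mutind => [T'|T0 _ v B IB|T IT T'|T _ v C IC T'] //; last 2 first.
- by rewrite /= IT -!map_comp.
- by rewrite /= IC -!map_comp.
elim=> [//|T0' IT' v' B'].
rewrite starN !map_cat -!map_comp [LHS]starN.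
rewrite -[Node (tree_map f T0') _ _]/(tree_map f (Node T0' v' B')) !IB.
rewrite -[Node (tree_map f T0) _ _]/(tree_map f (Node T0 v B)) IT'.
rewrite -!map_comp; congr (_ ++ (_ ++ _)).
by apply: eq_map => C /=; rewrite branches_map_bcat.
Qed.

Lemma tensor_ecast m n (e : m = n) (e' : m.+1 = n.+1) (x : V) (z : tpow V m) :
  x ⊗ ecast l (tpow V l) e z = ecast l (tpow V l) e' (x ⊗ z : tpow V m.+1).
Proof. by case: n / e e' => e'; rewrite (eq_axiomK e'). Qed.

Lemma tcat_tpure (v w : seq V) : tcat (tpure v) (tpure w) =
  ecast n (tpow V n) (size_cat v w) (tpure (v ++ w)).
Proof.
elim: v (size_cat v w) => [|x v IH] /= e; first by rewrite scale1r eq_axiomK.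
rewrite tens_liftE; last first.
  have [tl tr] := @tensor_bilinear k V (tpow V (size v + size w)).
  split=> [z a u u'|u a z z'] /=; first by rewrite (tl (tcat z (tpure w))).
  by rewrite ((tcat_bilinear _ _).1 (tpure w)) (tr u).
by rewrite (IH (size_cat v w)); exact: tensor_ecast.
Qed.

Lemma dsum_in_cast m n (e : m.+1 = n.+1) (U : tree unit) (x : tpow V m.+1) :
  dsum_in n (kD_basis k n.+1 U ⊗ ecast l (tpow V l) e x) =
  dsum_in m (kD_basis k m.+1 U ⊗ x) :> Pbar V.
Proof.
have e' : m = n by case: e.
by case: n / e' e => e; rewrite (eq_axiomK e).
Qed.

Lemma Pbar_op_dtree (op : forall A, tree A -> tree A -> seq (tree A))
    (T T' : tree V) : T <> Leaf -> T' <> Leaf ->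
  op _ (tree_map (fun=> tt) T) (tree_map (fun=> tt) T') =
    map (tree_map (fun=> tt)) (op _ T T') ->
  (forall U, U \in op _ T T' -> decos U = decos T ++ decos T') ->
  Pbar_op (@op unit) (dtree T) (dtree T') = \sum_(U <- op V T T') dtree U.
Proof.
move=> T0 T0' opM opD.
have decN A (X : tree A) : X <> Leaf -> exists v w, decos X = v :: w.
  case: X => // X v B _ /=; case: (decos X) => [|u l] /=; first by exists v, (bdecos B).
  by exists u, (l ++ v :: bdecos B).
have [v [w dT]] := decN _ _ T0; have [v' [w' dT']] := decN _ _ T0'.
rewrite {1}/dtree dT {1}/dtree dT' Pbar_opE PV_opE kD_opE; last 2 first.
- by rewrite (leaves_decos _).1 (decos_map _).1 size_map dT.
- by rewrite (leaves_decos _).1 (decos_map _).1 size_map dT'.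
rewrite (tcat_tpure (v :: w) (v' :: w')) opM big_map; set x := ecast _ _ _ _.
have G : linear (fun y => dsum_in (size w + (size w').+1) (y ⊗ x) : Pbar V).
  by move=> a y y'; rewrite /= ((tensor_bilinear _ _).1 x) dsum_in_linear.
rewrite (big_morph _ (linD G) (lin0 G)); apply: eq_big_seq => U /opD.
rewrite dT dT' /= => dU; rewrite /dtree dU.
exact: (dsum_in_cast (size_cat (v :: w) (v' :: w'))).
Qed.

Lemma Pbar_prec_dtree (T T' : tree V) : T <> Leaf -> T' <> Leaf ->
  Pbar_prec (dtree T) (dtree T') = \sum_(U <- tree_prec T T') dtree U.
Proof.
move=> T0 T0'; apply: (@Pbar_op_dtree (@tree_prec)) => // [|U UT].
- case: T T0 => // T1 v B _.
  by rewrite /= (star_map (fun=> tt)).2 -!map_comp.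
- by apply: (mem_star_decos V).1; rewrite starE // !mem_cat UT.
Qed.

Lemma Pbar_succ_dtree (T T' : tree V) : T <> Leaf -> T' <> Leaf ->
  Pbar_succ (dtree T) (dtree T') = \sum_(U <- tree_succ T T') dtree U.
Proof.
move=> T0 T0'; apply: (@Pbar_op_dtree (@tree_succ)) => // [|U UT].
- case: T' T0' => // T1 v B _.
  rewrite -[LHS]/([seq Node U tt (branches_map (fun=> tt) B)
    | U <- star (tree_map (fun=> tt) T) (tree_map (fun=> tt) T1)]).
  by rewrite (star_map (fun=> tt)).1 -!map_comp.
- by apply: (mem_star_decos V).1; rewrite starE // !mem_cat UT !orbT.
Qed.

Lemma Pbar_dot_dtree (T T' : tree V) : T <> Leaf -> T' <> Leaf ->
  Pbar_dot (dtree T) (dtree T') = \sum_(U <- tree_dot T T') dtree U.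
Proof.
move=> T0 T0'; apply: (@Pbar_op_dtree (@tree_dot)) => // [|U UT].
- case: T T0 => // T1 v B _; case: T' T0' => // T1' v' B' _.
  rewrite /= (star_map (fun=> tt)).2 -!map_comp.
  by apply: eq_map => C /=; rewrite branches_map_bcat.
- by apply: (mem_star_decos V).1; rewrite starE // !mem_cat UT !orbT.
Qed.

End DecoratedProducts.

(* Main.v *)
Require Import Defs.
From mathcomp Require Import all_boot all_algebra.
From mathcomp Require Import boolp zify.

Set Implicit Arguments.
Unset Strict Implicit.
Unset Printing Implicit Defensive.

Import GRing.Theory.
Local Open Scope ring_scope.

(** Write an element of the free algebra as a sum of trees [deco S l], where
    the shape [S] is a tree without decorations and the list [l] decorates its
    angles. Both halves of the structure are visible on such elements: the
    products act on the shapes and concatenate the lists, the braiding exchanges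
    the shapes and acts on the lists through the maps beta.

    The tridendriform axioms thus only concern shapes. Each of the seven axioms
    either exchanges two independent sums or reduces to the associativity of the
    product * on smaller trees; associativity of * is in turn the sum of the
    seven axioms, so both follow by one structural induction ([star_assoc]).

    The braiding axioms only concern lists of vectors. With s (u ⊗ v) written
    as a chosen sum of pure tensors, moving a list [l] past a list [m] becomes
    an explicit list [braid_ll l m] of pairs of lists, which computes beta on
    pure tensors ([beta_pure]). The compatibilities of the braiding with the
    products are the identities for moving a concatenation
    ([braid_ll_catr], [braid_ll_catl]), which hold summand by summand. The braid
    relation needs linearity, since the one for s only holds in the tensor
    product; it is propagated from three vectors to three lists by letting the
    lists grow one at a time ([yang_baxter_vvl], [yang_baxter_vll],
    [yang_baxter_lll]).

    For the universal property, the relations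
    T_0 \/_v T_1 = (T_0 > T[v]) < T_1 and
    T_0 \/_v T_1 \/_w .. = (T_0 > T[v]) . (T_1 \/_w ..) (with > and < standing
    for the products succ and prec, and a trivial T_0 or T_1 omitted) show that
    the trees T[v] generate, whence uniqueness ([Pbar_gen_ind]), and dictate the
    value [ev S l] of the wanted morphism. That value is multilinear in [l], so it defines a linear map, and
    it turns the products of trees into those of R by the same induction as for
    associativity ([ev_star]). Finally, a morphism for the products that
    commutes with the braidings on generators commutes with them everywhere,
    because the compatibilities compute the braiding of a product from the
    braidings of its factors ([morph_braided]). *)

(** * Linear and bilinear maps, tensor products *)

Section LinearAlgebra.
Variable k : fieldType.
Implicit Types U W X M N : lmodType k.

Lemma lin_sum U M (f : U -> M) : linear f ->
  forall I (r : seq I) (F : I -> U), f (\sum_(i <- r) F i) = \sum_(i <- r) f (F i).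
Proof. by move=> fl I r F; rewrite (big_morph f (linD fl) (lin0 fl)). Qed.

Lemma linear_idfun U : linear (@id U).
Proof. by []. Qed.

Lemma linear_comp U M N (f : M -> N) (g : U -> M) :
  linear f -> linear g -> linear (fun x => f (g x)).
Proof. by move=> fl gl a x y /=; rewrite gl fl. Qed.

Lemma linear_sumf U M I (r : seq I) (F : I -> U -> M) :
  (forall i, linear (F i)) -> linear (fun x => \sum_(i <- r) F i x).
Proof.
move=> Fl a x y; rewrite scaler_sumr -big_split /=.
by apply: eq_bigr => i _; rewrite Fl.
Qed.

Lemma linear_D U M (f g : U -> M) :
  linear f -> linear g -> linear (fun x => f x + g x).
Proof. by move=> fl gl a x y /=; rewrite fl gl scalerDr addrACA. Qed.

Lemma linear_Z U M a (f : U -> M) : linear f -> linear (fun x => a *: f x).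
Proof. by move=> fl b x y; rewrite fl scalerDr !scalerA mulrC. Qed.

Lemma bilinear_comp U U' W W' M (h : U' -> W' -> M) (f : U -> U') (g : W -> W') :
  is_bilinear h -> linear f -> linear g -> is_bilinear (fun u w => h (f u) (g w)).
Proof.
move=> [hl hr] fl gl; split=> [w|u] a x y /=.
  by rewrite fl (hl (g w)).
by rewrite gl (hr (f u)).
Qed.

Lemma linear_tensorl U W (w : W) : linear (fun u : U => u ⊗ w).
Proof. exact: (tensor_bilinear U W).1. Qed.

Lemma linear_tensorr U W (u : U) : linear (fun w : W => u ⊗ w).
Proof. exact: (tensor_bilinear U W).2. Qed.

Lemma bilinear_tensor U U' W W' (f : U -> U') (g : W -> W') :
  linear f -> linear g -> is_bilinear (fun u w => f u ⊗ g w).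
Proof. by move=> fl gl; apply: (bilinear_comp (tensor_bilinear U' W')). Qed.

Lemma tmap_linear U U' W W' (f : U -> U') (g : W -> W') :
  linear f -> linear g -> linear (tmap f g).
Proof. by move=> fl gl; apply/tens_lift_linear/bilinear_tensor. Qed.

Lemma tmapE U U' W W' (f : U -> U') (g : W -> W') u w :
  linear f -> linear g -> tmap f g (u ⊗ w) = f u ⊗ g w.
Proof. by move=> fl gl; rewrite /tmap tens_liftE //; apply: bilinear_tensor. Qed.

(** Gives a canonical decomposition into pure tensors, on which all explicit
    formulas for braidings rest. *)
Lemma trepr_sum U W (x : tens U W) : x = \sum_(p <- trepr x) p.1 ⊗ p.2.
Proof.
rewrite -[LHS]tpi_repr; elim: (trepr x) => [|[u w] s IH].
  by rewrite big_nil.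
rewrite big_cons -IH; symmetry; exact: tadd_pi.
Qed.

Lemma tens_lift_sum U W M (f : U -> W -> M) I (r : seq I) (F : I -> U) (G : I -> W) :
  is_bilinear f ->
  tens_lift f (\sum_(i <- r) F i ⊗ G i) = \sum_(i <- r) f (F i) (G i).
Proof.
move=> fb; rewrite (lin_sum (tens_lift_linear fb)).
by apply: eq_bigr => i _; rewrite tens_liftE.
Qed.

Lemma tens3_unique U W X M (g h : tens U (tens W X) -> M) :
  linear g -> linear h ->
  (forall u w x, g (u ⊗ (w ⊗ x)) = h (u ⊗ (w ⊗ x))) -> g =1 h.
Proof.
move=> gl hl gh; apply: tens_lift_unique => // u p; move: p.
apply: (@tens_lift_unique _ _ _ _ (fun p => g (u ⊗ p)) (fun p => h (u ⊗ p))).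
- by apply: linear_comp => //; apply: linear_tensorr.
- by apply: linear_comp => //; apply: linear_tensorr.
- exact: gh.
Qed.

Lemma tassoc_bil U W X (x : X) : is_bilinear (fun (u : U) (w : W) => u ⊗ (w ⊗ x)).
Proof. by apply: bilinear_tensor; [exact: linear_idfun | exact: linear_tensorl]. Qed.

Lemma tassocV_bil U W X (u : U) : is_bilinear (fun (w : W) (x : X) => u ⊗ w ⊗ x).
Proof. by apply: bilinear_tensor; [exact: linear_tensorr | exact: linear_idfun]. Qed.

Lemma tassoc_bil2 U W X :
  is_bilinear (fun (p : tens U W) (x : X) => tens_lift (fun u w => u ⊗ (w ⊗ x)) p).
Proof.
split=> [x|p a x y] /=; first exact/tens_lift_linear/tassoc_bil.
rewrite -tens_lift_linf; try exact: tassoc_bil.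
congr tens_lift; apply/funext => u; apply/funext => w.
by rewrite !linear_tensorr.
Qed.

Lemma tassocV_bil2 U W X :
  is_bilinear (fun (u : U) (p : tens W X) => tens_lift (fun w x => u ⊗ w ⊗ x) p).
Proof.
split=> [p a x y|u] /=; last exact/tens_lift_linear/tassocV_bil.
rewrite -tens_lift_linf; try exact: tassocV_bil.
congr tens_lift; apply/funext => u; apply/funext => w.
by rewrite !linear_tensorl.
Qed.

Lemma tassoc_linear U W X : linear (@tassoc k U W X).
Proof. exact/tens_lift_linear/tassoc_bil2. Qed.

Lemma tassocV_linear U W X : linear (@tassocV k U W X).
Proof. exact/tens_lift_linear/tassocV_bil2. Qed.

Lemma tassocE U W X (u : U) (w : W) (x : X) : tassoc (u ⊗ w ⊗ x) = u ⊗ (w ⊗ x).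
Proof.
rewrite /tassoc tens_liftE; last exact: tassoc_bil2.
by rewrite tens_liftE //; apply: tassoc_bil.
Qed.

Lemma tassocVE U W X (u : U) (w : W) (x : X) : tassocV (u ⊗ (w ⊗ x)) = u ⊗ w ⊗ x.
Proof.
rewrite /tassocV tens_liftE; last exact: tassocV_bil2.
by rewrite tens_liftE //; apply: tassocV_bil.
Qed.

Lemma act12_linear U X (t : tens U U -> tens U U) : linear t ->
  linear (@act12 k U X t).
Proof.
move=> tl; apply: linear_comp; first exact: tassoc_linear.
by apply: linear_comp (@tassocV_linear _ _ _); apply: tmap_linear.
Qed.

Lemma act12E U X (t : tens U U -> tens U U) u w (x : X)
    I (r : seq I) (F G : I -> U) : linear t ->
  t (u ⊗ w) = \sum_(i <- r) F i ⊗ G i ->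
  act12 t (u ⊗ (w ⊗ x)) = \sum_(i <- r) F i ⊗ (G i ⊗ x).
Proof.
move=> tl tE; rewrite /act12 tassocVE tmapE // tE.
rewrite (lin_sum (linear_tensorl x)) (lin_sum (@tassoc_linear _ _ _)).
by apply: eq_bigr => i _; rewrite tassocE.
Qed.

Lemma sigma1_linear U (t : tens U U -> tens U U) : linear t -> linear (sigma1 t).
Proof. exact: act12_linear. Qed.

Lemma sigma2_linear U (t : tens U U -> tens U U) : linear t -> linear (sigma2 t).
Proof. by move=> tl; apply: tmap_linear. Qed.

Lemma sigma2E U (t : tens U U -> tens U U) u w x
    I (r : seq I) (F G : I -> U) : linear t ->
  t (w ⊗ x) = \sum_(i <- r) F i ⊗ G i ->
  sigma2 t (u ⊗ (w ⊗ x)) = \sum_(i <- r) u ⊗ (F i ⊗ G i).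
Proof.
by move=> tl tE; rewrite /sigma2 tmapE // tE (lin_sum (linear_tensorr u)).
Qed.

(** Linear identities are checked on spanning sets by showing that the elements
    satisfying them form a subspace. *)
Definition subspace U (P : U -> Prop) : Prop :=
  P 0 /\ forall a x y, P x -> P y -> P (a *: x + y).

Lemma subspaceZ U (P : U -> Prop) a x : subspace P -> P x -> P (a *: x).
Proof. by move=> [P0 PL] Px; rewrite -[_ *: _]addr0; apply: PL. Qed.

Lemma subspace_sum U (P : U -> Prop) I (r : seq I) (F : I -> U) :
  subspace P -> (forall i, P (F i)) -> P (\sum_(i <- r) F i).
Proof.
move=> [P0 PL] PF; elim/big_rec: _ => // i x _ Px.
by rewrite -[F i]scale1r; apply: PL.
Qed.

Lemma subspace_eq U M (g h : U -> M) :
  linear g -> linear h -> subspace (fun x => g x = h x).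
Proof. by move=> gl hl; split=> [|a x y gx gy]; rewrite ?lin0 // gl gx gy hl. Qed.

End LinearAlgebra.

(** * Braidings computed on decomposed tensors *)

Section Hexagons.
Variables (k : fieldType) (U : lmodType k) (t : tens U U -> tens U U).
Hypothesis tl : linear t.
Variable op : U -> U -> U.
Hypothesis opb : is_bilinear op.

Let opl : linear (tens_lift op) := tens_lift_linear opb.
Let Idl := @linear_idfun k U.

(** The right-hand sides of the two compatibilities of a braiding with a
    product, for whatever decompositions of the intermediate tensors are at
    hand: lists of vectors for trees, images of such in the target algebra. *)
Lemma hexagonrE x y z I (r : seq I) (F G : I -> U)
    J (r' : I -> seq J) (F' G' : I -> J -> U) :
  t (x ⊗ y) = \sum_(i <- r) F i ⊗ G i ->
  (forall i, t (G i ⊗ z) = \sum_(j <- r' i) F' i j ⊗ G' i j) ->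
  tmap (tens_lift op) id (tassocV (sigma2 t (sigma1 t (x ⊗ (y ⊗ z))))) =
  \sum_(i <- r) \sum_(j <- r' i) op (F i) (F' i j) ⊗ G' i j.
Proof.
move=> E1 E2; rewrite [sigma1 t _](act12E _ tl E1) (lin_sum (sigma2_linear tl)).
rewrite (lin_sum (@tassocV_linear _ _ _ _)) (lin_sum (tmap_linear opl Idl)).
apply: eq_bigr => i _; rewrite (sigma2E _ tl (E2 i)).
rewrite (lin_sum (@tassocV_linear _ _ _ _)) (lin_sum (tmap_linear opl Idl)).
by apply: eq_bigr => j _; rewrite tassocVE tmapE // tens_liftE.
Qed.

Lemma hexagonlE x y z I (r : seq I) (F G : I -> U)
    J (r' : I -> seq J) (F' G' : I -> J -> U) :
  t (y ⊗ z) = \sum_(i <- r) F i ⊗ G i ->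
  (forall i, t (x ⊗ F i) = \sum_(j <- r' i) F' i j ⊗ G' i j) ->
  tmap id (tens_lift op) (sigma1 t (sigma2 t (x ⊗ (y ⊗ z)))) =
  \sum_(i <- r) \sum_(j <- r' i) F' i j ⊗ op (G' i j) (G i).
Proof.
move=> E1 E2; rewrite (sigma2E _ tl E1) (lin_sum (sigma1_linear tl)).
rewrite (lin_sum (tmap_linear Idl opl)).
apply: eq_bigr => i _; rewrite [sigma1 t _](act12E _ tl (E2 i)).
rewrite (lin_sum (tmap_linear Idl opl)).
by apply: eq_bigr => j _; rewrite tmapE // tens_liftE.
Qed.

Lemma tmap_opr (x y z : U) : tmap id (tens_lift op) (x ⊗ (y ⊗ z)) = x ⊗ op y z.
Proof. by rewrite tmapE // tens_liftE. Qed.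

Lemma tmap_opl (x y z : U) :
  tmap (tens_lift op) id (tassocV (x ⊗ (y ⊗ z))) = op x y ⊗ z.
Proof. by rewrite tassocVE tmapE // tens_liftE. Qed.

End Hexagons.

(** A family [D] of vectors on which the braiding [t] is known and stable; it
    will be the whole space of vectors, then the family of decorated trees. *)
Section DecomposedBraiding.
Variables (k : fieldType) (U : lmodType k) (t : tens U U -> tens U U).
Hypothesis tl : linear t.
Variables (A : Type) (D : A -> U) (r : A -> A -> seq (A * A)).
Hypothesis tD : forall a b, t (D a ⊗ D b) = \sum_(p <- r a b) D p.1 ⊗ D p.2.

Lemma sigma1D a b x :
  sigma1 t (D a ⊗ (D b ⊗ x)) = \sum_(p <- r a b) D p.1 ⊗ (D p.2 ⊗ x).
Proof. exact: act12E. Qed.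

Lemma sigma2D a b x :
  sigma2 t (x ⊗ (D a ⊗ D b)) = \sum_(p <- r a b) x ⊗ (D p.1 ⊗ D p.2).
Proof. exact: sigma2E. Qed.

Lemma sigma12D a b c : sigma1 t (sigma2 t (D a ⊗ (D b ⊗ D c))) =
  \sum_(p <- r b c) \sum_(q <- r a p.1) D q.1 ⊗ (D q.2 ⊗ D p.2).
Proof.
rewrite sigma2D (lin_sum (sigma1_linear tl)).
by apply: eq_bigr => p _; rewrite [LHS]sigma1D.
Qed.

Lemma sigma21D a b c : sigma2 t (sigma1 t (D a ⊗ (D b ⊗ D c))) =
  \sum_(p <- r a b) \sum_(q <- r p.2 c) D p.1 ⊗ (D q.1 ⊗ D q.2).
Proof.
rewrite sigma1D (lin_sum (sigma2_linear tl)).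
by apply: eq_bigr => p _; rewrite [LHS]sigma2D.
Qed.

Lemma sigma121D a b c : sigma1 t (sigma2 t (sigma1 t (D a ⊗ (D b ⊗ D c)))) =
  \sum_(p <- r a b) \sum_(q <- r p.2 c) \sum_(o <- r p.1 q.1)
    D o.1 ⊗ (D o.2 ⊗ D q.2).
Proof.
rewrite sigma21D (lin_sum (sigma1_linear tl)); apply: eq_bigr => p _.
rewrite (lin_sum (sigma1_linear tl)); apply: eq_bigr => q _.
by rewrite [LHS]sigma1D.
Qed.

Lemma sigma212D a b c : sigma2 t (sigma1 t (sigma2 t (D a ⊗ (D b ⊗ D c)))) =
  \sum_(p <- r b c) \sum_(q <- r a p.1) \sum_(o <- r q.2 p.2)
    D q.1 ⊗ (D o.1 ⊗ D o.2).
Proof.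
rewrite sigma12D (lin_sum (sigma2_linear tl)); apply: eq_bigr => p _.
rewrite (lin_sum (sigma2_linear tl)); apply: eq_bigr => q _.
by rewrite [LHS]sigma2D.
Qed.

End DecomposedBraiding.

(** * The braiding of tensor powers on lists of vectors *)

Section ListBraiding.
Variables (k : fieldType) (V : lmodType k) (s : tens V V -> tens V V).
Hypothesis sl : linear s.

(** In the three definitions below, the first argument moves to the right past
    the second one. The results are lists of pairs standing for sums of pure
    tensors; each pair is in the order of the target. *)
Definition braid_vv (u v : V) : seq (V * V) := trepr (s (u ⊗ v)).

Fixpoint braid_vl (v : V) (l : seq V) : seq (seq V * V) :=
  if l is w :: l' then
    [seq (p.1 :: q.1, q.2) | p <- braid_vv v w, q <- braid_vl p.2 l']
  else [:: ([::], v)].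

Fixpoint braid_ll (l m : seq V) : seq (seq V * seq V) :=
  if l is v :: l' then
    [seq (q.1, q.2 :: p.2) | p <- braid_ll l' m, q <- braid_vl v p.1]
  else [:: (m, [::])].

Lemma braid_vv_sum u v : s (u ⊗ v) = \sum_(p <- braid_vv u v) p.1 ⊗ p.2.
Proof. exact: trepr_sum. Qed.

Section Sums.
Variable M : nmodType.

Lemma braid_vl_nil v (F : seq V -> V -> M) :
  \sum_(p <- braid_vl v [::]) F p.1 p.2 = F [::] v.
Proof. by rewrite big_seq1. Qed.

Lemma braid_vl_cons v w l (F : seq V -> V -> M) :
  \sum_(p <- braid_vl v (w :: l)) F p.1 p.2 =
  \sum_(p <- braid_vv v w) \sum_(q <- braid_vl p.2 l) F (p.1 :: q.1) q.2.
Proof. by rewrite /= big_allpairs_dep. Qed.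

Lemma braid_ll_nil m (F : seq V -> seq V -> M) :
  \sum_(p <- braid_ll [::] m) F p.1 p.2 = F m [::].
Proof. by rewrite big_seq1. Qed.

Lemma braid_ll_cons v l m (F : seq V -> seq V -> M) :
  \sum_(p <- braid_ll (v :: l) m) F p.1 p.2 =
  \sum_(p <- braid_ll l m) \sum_(q <- braid_vl v p.1) F q.1 (q.2 :: p.2).
Proof. by rewrite /= big_allpairs_dep. Qed.

Lemma braid_vl_cat v l m (F : seq V -> V -> M) :
  \sum_(p <- braid_vl v (l ++ m)) F p.1 p.2 =
  \sum_(p <- braid_vl v l) \sum_(q <- braid_vl p.2 m) F (p.1 ++ q.1) q.2.
Proof.
elim: l v F => [|w l IH] v F.
  by rewrite (braid_vl_nil v (fun x y => \sum_(q <- braid_vl y m) F (x ++ q.1) q.2)).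
rewrite cat_cons braid_vl_cons.
rewrite (braid_vl_cons _ _ _ (fun x y => \sum_(q <- braid_vl y m) F (x ++ q.1) q.2)).
by apply: eq_bigr => p _; rewrite (IH _ (fun x y => F (p.1 :: x) y)).
Qed.

(** Moving past a concatenation, and moving a concatenation. The two sides run
    over the same pairs up to the order of independent sums, whence the
    arbitrary [F]. *)
Lemma braid_ll_catr l m n (F : seq V -> seq V -> M) :
  \sum_(p <- braid_ll l (m ++ n)) F p.1 p.2 =
  \sum_(p <- braid_ll l m) \sum_(q <- braid_ll p.2 n) F (p.1 ++ q.1) q.2.
Proof.
elim: l F => [|v l IH] F.
  rewrite braid_ll_nil.
  rewrite (braid_ll_nil _ (fun x y => \sum_(q <- braid_ll y n) F (x ++ q.1) q.2)).
  by rewrite (braid_ll_nil _ (fun x y => F (m ++ x) y)).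
rewrite braid_ll_cons.
rewrite (braid_ll_cons _ _ _ (fun x y => \sum_(q <- braid_ll y n) F (x ++ q.1) q.2)).
rewrite (IH (fun x y => \sum_(q <- braid_vl v x) F q.1 (q.2 :: y))).
apply: eq_bigr => p _.
under [RHS]eq_bigr => q _ do
  rewrite (braid_ll_cons _ _ _ (fun x y => F (q.1 ++ x) y)).
rewrite exchange_big; apply: eq_bigr => q _ /=.
by rewrite (braid_vl_cat _ _ _ (fun x y => F x (y :: q.2))).
Qed.

Lemma braid_ll_catl l m n (F : seq V -> seq V -> M) :
  \sum_(p <- braid_ll (l ++ m) n) F p.1 p.2 =
  \sum_(p <- braid_ll m n) \sum_(q <- braid_ll l p.1) F q.1 (q.2 ++ p.2).
Proof.
elim: l F => [|v l IH] F.
  by apply: eq_bigr => p _; rewrite (braid_ll_nil _ (fun x y => F x (y ++ p.2))).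
rewrite cat_cons braid_ll_cons.
rewrite (IH (fun x y => \sum_(q <- braid_vl v x) F q.1 (q.2 :: y))).
by apply: eq_bigr => p _; rewrite (braid_ll_cons _ _ _ (fun x y => F x (y ++ p.2))).
Qed.

End Sums.

Lemma size_braid_vl v l p : p \in braid_vl v l -> size p.1 = size l.
Proof.
elim: l v p => [|w l IH] v p; first by rewrite inE => /eqP ->.
by case/allpairsPdep=> q [r [_ /IH h ->]]; rewrite /= h.
Qed.

Lemma size_braid_ll l m p : p \in braid_ll l m -> size p.1 = size m /\ size p.2 = size l.
Proof.
elim: l p => [|v l IH] p; first by rewrite inE => /eqP ->.
by case/allpairsPdep=> q [r [/IH[h1 h2] /size_braid_vl h ->]]; rewrite /= h h1 h2.
Qed.

Section Multilinear.
Variable M : lmodType k.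

Definition mlin (F : seq V -> M) : Prop := forall (l1 l2 : seq V) a (u v : V),
  F (l1 ++ (a *: u + v) :: l2) = a *: F (l1 ++ u :: l2) + F (l1 ++ v :: l2).

Lemma mlin_cons F u : mlin F -> mlin (fun l => F (u :: l)).
Proof. by move=> Fl l1 l2; apply: (Fl (u :: l1)). Qed.

Lemma mlin_head F l : mlin F -> linear (fun u => F (u :: l)).
Proof. by move=> Fl a u v; apply: (Fl [::]). Qed.

Lemma mlin_sum I (r : seq I) (F : I -> seq V -> M) :
  (forall i, mlin (F i)) -> mlin (fun l => \sum_(i <- r) F i l).
Proof.
move=> Fl l1 l2 a u v; rewrite scaler_sumr -big_split /=.
by apply: eq_bigr => i _; rewrite Fl.
Qed.

Lemma braid_vv_lift u v (F : V -> V -> M) :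
  \sum_(p <- braid_vv u v) F p.1 p.2 = tens_lift F (s (u ⊗ v)).
Proof. by []. Qed.

Lemma braid_vv_bilinear (F : V -> V -> M) : is_bilinear F ->
  is_bilinear (fun u v => \sum_(p <- braid_vv u v) F p.1 p.2).
Proof.
move=> Fb; split=> [v a x y|u a x y] /=; rewrite !braid_vv_lift.
  by rewrite linear_tensorl sl tens_lift_linear.
by rewrite linear_tensorr sl tens_lift_linear.
Qed.

Definition mlin_lin (F : seq V -> V -> M) : Prop :=
  (forall v, mlin (F ^~ v)) /\ (forall l, linear (F l)).

(** The chosen decompositions depend on the vectors in no linear way, but the
    sums of a multilinear function over them do. *)
Lemma braid_vl_mlin (F : seq V -> V -> M) : mlin_lin F ->
  mlin_lin (fun l v => \sum_(p <- braid_vl v l) F p.1 p.2).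
Proof.
(* Linearity in the moving vector and in the entries of the list have to be
   proved together, since [v] meets the first entry. *)
move=> FL; suff H l : (forall F, mlin_lin F ->
    linear (fun v => \sum_(p <- braid_vl v l) F p.1 p.2)) /\
  (forall F l1 l2 a u w v, mlin_lin F -> l = l1 ++ (a *: u + w) :: l2 ->
    \sum_(p <- braid_vl v l) F p.1 p.2 =
    a *: (\sum_(p <- braid_vl v (l1 ++ u :: l2)) F p.1 p.2) +
    \sum_(p <- braid_vl v (l1 ++ w :: l2)) F p.1 p.2).
  by split=> [v l1 l2 a u w|l]; [apply: (H _).2 | apply: (H l).1].
elim: l {F FL} => [|w0 l [IH1 IH2]].
  split=> [F [_ Fl] a u v|F [|? ?] //]; rewrite !braid_vl_nil; exact: Fl.
have K (F : seq V -> V -> M) (FL : mlin_lin F) :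
    is_bilinear (fun w' v' => \sum_(q <- braid_vl v' l) F (w' :: q.1) q.2).
  split=> [v' a x y|w']; last first.
    apply: (IH1 (fun x y => F (w' :: x) y)).
    by split=> [v|m]; [exact: (mlin_cons w' (FL.1 v)) | exact: FL.2].
  apply: (@linear_sumf k V M _ _ (fun q x => F (x :: q.1) q.2)) => q.
  exact: (mlin_head q.1 (FL.1 q.2)).
split=> [F FL a u v|F [|w1 l1] l2 a u w v FL /=].
- by rewrite !braid_vl_cons; apply: (braid_vv_bilinear (K F FL)).1.
- by case=> -> <-; rewrite !braid_vl_cons; apply: (braid_vv_bilinear (K F FL)).2.
case=> <- lE; rewrite !braid_vl_cons scaler_sumr -big_split /=.
apply: eq_bigr => p _; apply: (IH2 (fun x y => F (p.1 :: x) y)) => //.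
by split=> [x|m]; [exact: (mlin_cons p.1 (FL.1 x)) | exact: FL.2].
Qed.

End Multilinear.
End ListBraiding.

(** * The braid relation on lists *)

Section ListYangBaxter.
Variables (k : fieldType) (V M : lmodType k) (s : tens V V -> tens V V).
Hypothesis sb : is_braiding s.

Notation braid_vv := (braid_vv s).
Notation braid_vl := (braid_vl s).
Notation braid_ll := (braid_ll s).

Let sl : linear s := sb.1.

(** The braid relation for s, read through a trilinear map: the decompositions
    into pure tensors on the two sides need not match term by term. *)
Lemma yang_baxter_vvv (G : V -> V -> V -> M) u v w :
  (forall y z, linear (fun x => G x y z)) ->
  (forall x z, linear (fun y => G x y z)) ->
  (forall x y, linear (G x y)) ->
  \sum_(p <- braid_vv v w) \sum_(q <- braid_vv u p.1)
    \sum_(o <- braid_vv q.2 p.2) G q.1 o.1 o.2 =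
  \sum_(p <- braid_vv u v) \sum_(q <- braid_vv p.2 w)
    \sum_(o <- braid_vv p.1 q.1) G o.1 o.2 q.2.
Proof.
move=> G1 G2 G3.
have Gb x : is_bilinear (G x) by split.
have gb : is_bilinear (fun x p => tens_lift (G x) p).
  split=> [p a x y|x]; last exact: tens_lift_linear.
  rewrite -tens_lift_linf //; congr tens_lift.
  by apply/funext => u'; apply/funext => v'; apply: G1.
have gl := tens_lift_linear gb; set g := tens_lift _ in gl.
have gE x y z : g (x ⊗ (y ⊗ z)) = G x y z by rewrite /g !tens_liftE.
have sD := braid_vv_sum s.
have := congr1 g (sb.2 (u ⊗ (v ⊗ w))).
rewrite (sigma121D sl (D := id) sD) (sigma212D sl (D := id) sD).
rewrite (lin_sum gl) [RHS](lin_sum gl) => E.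
transitivity (\sum_(p <- braid_vv v w) g (\sum_(q <- braid_vv u p.1)
    \sum_(o <- braid_vv q.2 p.2) q.1 ⊗ (o.1 ⊗ o.2))).
  apply: eq_bigr => p _; rewrite (lin_sum gl); apply: eq_bigr => q _.
  by rewrite (lin_sum gl); apply: eq_bigr => o _; rewrite gE.
rewrite -E; apply: eq_bigr => p _; rewrite (lin_sum gl); apply: eq_bigr => q _.
by rewrite (lin_sum gl); apply: eq_bigr => o _; rewrite gE.
Qed.

(** Moving two vectors past a list commutes with braiding the two vectors. By
    induction on the list, each new vector being handled by the relation for
    three vectors. *)
Lemma yang_baxter_vvl (G : seq V -> V -> V -> M) u v l :
  (forall y z, mlin (fun x => G x y z)) ->
  (forall x z, linear (fun y => G x y z)) ->
  (forall x y, linear (G x y)) ->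
  \sum_(p <- braid_vl v l) \sum_(q <- braid_vl u p.1)
    \sum_(o <- braid_vv q.2 p.2) G q.1 o.1 o.2 =
  \sum_(p <- braid_vv u v) \sum_(q <- braid_vl p.2 l)
    \sum_(o <- braid_vl p.1 q.1) G o.1 o.2 q.2.
Proof.
elim: l u v G => [|w l IH] u v G G1 G2 G3.
  rewrite (braid_vl_nil _ _ (fun x y =>
    \sum_(q <- braid_vl u x) \sum_(o <- braid_vv q.2 y) G q.1 o.1 o.2)).
  rewrite (braid_vl_nil _ _ (fun x z => \sum_(o <- braid_vv z v) G x o.1 o.2)).
  apply: eq_bigr => p _.
  rewrite (braid_vl_nil _ _ (fun x y => \sum_(o <- braid_vl p.1 x) G o.1 o.2 y)).
  by rewrite (braid_vl_nil _ _ (fun x z => G x z p.2)).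
rewrite (braid_vl_cons _ _ _ _ (fun x y =>
    \sum_(q <- braid_vl u x) \sum_(o <- braid_vv q.2 y) G q.1 o.1 o.2)).
(* The effect on the tail of the list, as a trilinear function of the three
   heads. *)
pose H w' y x := \sum_(q <- braid_vl x l) \sum_(o <- braid_vl y q.1) G (w' :: o.1) o.2 q.2.
transitivity (\sum_(p <- braid_vv v w) \sum_(q <- braid_vv u p.1)
    \sum_(o <- braid_vv q.2 p.2) H q.1 o.1 o.2).
  apply: eq_bigr => p _.
  under eq_bigr => q _ do
    rewrite (braid_vl_cons _ _ _ _ (fun x z => \sum_(o <- braid_vv z q.2) G x o.1 o.2)).
  rewrite exchange_big /=; apply: eq_bigr => q _.
  rewrite (IH q.2 p.2 (fun x y z => G (q.1 :: x) y z)) // => y z.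
  exact: (mlin_cons q.1 (G1 y z)).
have L2 w' z : mlin_lin (fun x y => G (w' :: x) y z).
  by split=> [y|x] //; apply: (mlin_cons (F := fun x => G x y z)).
have L3 w' y : mlin_lin (fun x z => \sum_(o <- braid_vl y x) G (w' :: o.1) o.2 z).
  split=> [z|x]; first exact: (braid_vl_mlin sl (L2 w' z)).1.
  exact: linear_sumf.
rewrite yang_baxter_vvv; first last.
- by move=> x y; apply: (braid_vl_mlin sl (L3 x y)).2.
- move=> x z; apply: linear_sumf => q; exact: (braid_vl_mlin sl (L2 x q.2)).2.
- move=> y z; apply: linear_sumf => q; apply: linear_sumf => o.
  exact: (mlin_head o.1 (G1 o.2 q.2)).
apply: eq_bigr => p _.
rewrite (braid_vl_cons _ _ _ _ (fun x z => \sum_(o <- braid_vl p.1 x) G o.1 o.2 z)).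
apply: eq_bigr => q _; rewrite exchange_big /=.
by apply: eq_bigr => o _; rewrite (braid_vl_cons _ _ _ _ (fun x y => G x y o.2)).
Qed.

(** The vector [u] and the list [m] move past [n]. Prepending [v] to [m] costs
    one exchange of [u] and [v], which [yang_baxter_vvl] carries through
    [n]. *)
Lemma yang_baxter_vll (G : seq V -> seq V -> V -> M) u m n :
  (forall y z, mlin (fun x => G x y z)) ->
  (forall x z, mlin (fun y => G x y z)) ->
  (forall x y, linear (G x y)) ->
  \sum_(p <- braid_vl u m) \sum_(q <- braid_vl p.2 n)
    \sum_(o <- braid_ll p.1 q.1) G o.1 o.2 q.2 =
  \sum_(p <- braid_ll m n) \sum_(q <- braid_vl u p.1)
    \sum_(o <- braid_vl q.2 p.2) G q.1 o.1 o.2.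
Proof.
elim: m u G => [|v m IH] u G G1 G2 G3.
  rewrite (braid_vl_nil _ _ (fun x y =>
    \sum_(q <- braid_vl y n) \sum_(o <- braid_ll x q.1) G o.1 o.2 q.2)).
  rewrite (braid_ll_nil _ _ (fun x y =>
    \sum_(q <- braid_vl u x) \sum_(o <- braid_vl q.2 y) G q.1 o.1 o.2)).
  apply: eq_bigr => p _.
  rewrite (braid_ll_nil _ _ (fun x y => G x y p.2)).
  by rewrite (braid_vl_nil _ _ (fun x y => G p.1 x y)).
rewrite (braid_vl_cons _ _ _ _ (fun x y =>
  \sum_(q <- braid_vl y n) \sum_(o <- braid_ll x q.1) G o.1 o.2 q.2)).
rewrite (braid_ll_cons _ _ _ _ (fun x y =>
  \sum_(q <- braid_vl u x) \sum_(o <- braid_vl q.2 y) G q.1 o.1 o.2)).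
have L y z : mlin_lin (fun x w => G x (w :: y) z).
  by split=> [w|x] //; apply: (mlin_head (F := fun y => G x y z)).
transitivity (\sum_(p <- braid_vv u v) \sum_(q <- braid_ll m n) \sum_(o <- braid_vl p.2 q.1)
    \sum_(c <- braid_vl o.2 q.2) \sum_(d <- braid_vl p.1 o.1) G d.1 (d.2 :: c.1) c.2).
  apply: eq_bigr => p _.
  under eq_bigr => q _ do under eq_bigr => o _ do
    rewrite (braid_ll_cons _ _ _ _ (fun x y => G x y o.2)).
  rewrite (IH _ (fun x y z => \sum_(c <- braid_vl p.1 x) G c.1 (c.2 :: y) z)).
  - by [].
  - by move=> y z; apply: (braid_vl_mlin sl (L y z)).1.
  - move=> x z; apply: mlin_sum => c.
    exact: (mlin_cons c.2 (G2 c.1 z)).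
  - by move=> x y; apply: linear_sumf.
rewrite exchange_big /=; apply: eq_bigr => p _.
under [RHS]eq_bigr => q _ do under eq_bigr => o _ do
  rewrite (braid_vl_cons _ _ _ _ (fun x y => G o.1 x y)).
rewrite (yang_baxter_vvl _ _ _ 
  (G := fun x y z => \sum_(c <- braid_vl z p.2) G x (y :: c.1) c.2)).
- apply: eq_bigr => q _; apply: eq_bigr => o _.
  by rewrite exchange_big.
- by move=> y z; apply: mlin_sum => c; apply: G1.
- move=> x z; apply: linear_sumf => c; exact: (mlin_head c.1 (G2 x c.2)).
- move=> x y; apply: (braid_vl_mlin sl (F := fun n z => G x (y :: n) z) _).2.
  by split=> [z|l] //; apply: (mlin_cons y (G2 x z)).
Qed.

(** Prepending [u] to [l] inserts a copy of [yang_baxter_vll] for the images of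
    [m] and [n] after they passed [l]; the remaining sums are independent and
    can be exchanged. *)
Lemma yang_baxter_lll (G : seq V -> seq V -> seq V -> M) l m n :
  (forall y z, mlin (fun x => G x y z)) ->
  (forall x z, mlin (fun y => G x y z)) ->
  (forall x y, mlin (G x y)) ->
  \sum_(p <- braid_ll l m) \sum_(q <- braid_ll p.2 n)
    \sum_(o <- braid_ll p.1 q.1) G o.1 o.2 q.2 =
  \sum_(p <- braid_ll m n) \sum_(q <- braid_ll l p.1)
    \sum_(o <- braid_ll q.2 p.2) G q.1 o.1 o.2.
Proof.
elim: l G => [|u l IH] G G1 G2 G3.
  rewrite (braid_ll_nil _ _ (fun x y =>
    \sum_(q <- braid_ll y n) \sum_(o <- braid_ll x q.1) G o.1 o.2 q.2)).
  rewrite (braid_ll_nil _ _ (fun x y => \sum_(o <- braid_ll m x) G o.1 o.2 y)).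
  apply: eq_bigr => p _.
  rewrite (braid_ll_nil _ _ (fun x y => \sum_(o <- braid_ll y p.2) G x o.1 o.2)).
  by rewrite (braid_ll_nil _ _ (fun x y => G p.1 x y)).
rewrite (braid_ll_cons _ _ _ _ (fun x y =>
  \sum_(q <- braid_ll y n) \sum_(o <- braid_ll x q.1) G o.1 o.2 q.2)).
have L y z : mlin_lin (fun x w => G y x (w :: z)).
  by split=> [w|x] //; apply: (mlin_head (F := fun z => G y x z)).
transitivity (\sum_(p <- braid_ll l m) \sum_(q <- braid_ll p.2 n) \sum_(o <- braid_ll p.1 q.1)
    \sum_(c <- braid_vl u o.1) \sum_(d <- braid_vl c.2 o.2) G c.1 d.1 (d.2 :: q.2)).
  apply: eq_bigr => p _.
  under eq_bigr => q _ do rewrite (braid_ll_cons _ _ _ _ (fun x y =>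
    \sum_(o <- braid_ll q.1 x) G o.1 o.2 y)).
  rewrite exchange_big /=; apply: eq_bigr => q _.
  apply: (yang_baxter_vll (G := fun x y z => G x y (z :: q.2))) => // x y.
  exact: (mlin_head q.2 (G3 x y)).
rewrite (IH (fun x y z =>
  \sum_(c <- braid_vl u x) \sum_(d <- braid_vl c.2 y) G c.1 d.1 (d.2 :: z))).
- apply: eq_bigr => p _.
  rewrite (braid_ll_cons _ _ _ _ (fun x y => \sum_(o <- braid_ll y p.2) G x o.1 o.2)).
  apply: eq_bigr => q _.
  under [RHS]eq_bigr => c _ do rewrite (braid_ll_cons _ _ _ _ (fun x y => G c.1 x y)).
  by rewrite exchange_big.
- move=> y z.
  apply: (braid_vl_mlin sl (F := fun x w => \sum_(d <- braid_vl w y) G x d.1 (d.2 :: z)) _).1.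
  split=> [w|x]; first by apply: mlin_sum => d.
  exact: (braid_vl_mlin sl (L x z)).2.
- by move=> x z; apply: mlin_sum => c; apply: (braid_vl_mlin sl (L c.1 z)).1.
- move=> x y; apply: mlin_sum => c; apply: mlin_sum => d.
  exact: (mlin_cons d.2 (G3 c.1 d.1)).
Qed.

End ListYangBaxter.

(** * The maps beta on pure tensors *)

Section TensorPowers.
Variables (k : fieldType) (V : lmodType k).

(** The pure tensor of the entries of [l], meant for lists of length [n]. Having
    [n] as an argument, instead of computing it from [l], keeps casts between
    tensor powers out of all statements. *)
Fixpoint pure (n : nat) (l : seq V) : tpow V n :=
  match n return tpow V n with
  | 0 => (1 : k^o)
  | m.+1 => head 0 l ⊗ pure m (behead l)
  end.

Lemma tpureE (l : seq V) : tpure l = pure (size l) l.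
Proof. by elim: l => //= v l ->. Qed.

Lemma pure_mlin n l1 l2 a (u v : V) : (size l1 < n)%N ->
  pure n (l1 ++ (a *: u + v) :: l2) =
  a *: pure n (l1 ++ u :: l2) + pure n (l1 ++ v :: l2).
Proof.
elim: l1 n => [|x l1 IH] [|n] //= h; first exact: linear_tensorl.
by rewrite IH // linear_tensorr.
Qed.

Lemma tpow_ind n (P : tpow V n -> Prop) : subspace P ->
  (forall l, size l = n -> P (pure n l)) -> forall x, P x.
Proof.
elim: n P => [|n IH] P sP Ptp x.
  have -> : x = x *: (1 : k^o) by rewrite /GRing.scale /= mulr1.
  by apply: subspaceZ => //; apply: (Ptp [::]).
rewrite (trepr_sum x); apply: subspace_sum => // -[v y] /=; move: y.
apply: (IH (fun y => P (v ⊗ y))).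
  split=> [|a y z Py Pz]; first by rewrite (lin0 (linear_tensorr v)); apply: sP.1.
  by rewrite linear_tensorr; apply: sP.2.
by move=> l ln; apply: (Ptp (v :: l)); rewrite /= ln.
Qed.

Lemma tcat_pure m n (l l' : seq V) : size l = m ->
  tcat (pure m l) (pure n l') = pure (m + n) (l ++ l').
Proof.
elim: l m => [|v l IH] m <- /=; first by rewrite scale1r.
rewrite tens_liftE ?IH //.
apply: (bilinear_comp (tensor_bilinear V _) (@linear_idfun _ _)).
exact: (tcat_bilinear V _ _).1.
Qed.

Lemma tsplit_linear m n : linear (@tsplit k V m n).
Proof.
elim: m => [|m IH] /=; first exact: linear_tensorr.
apply: tens_lift_linear; split=> [z a x y|v a x y] /=.
  by rewrite linear_tensorl tassocV_linear.
by rewrite IH linear_tensorr tassocV_linear.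
Qed.

Lemma tsplit_pure m n (l l' : seq V) : size l = m ->
  tsplit (pure (m + n) (l ++ l')) = pure m l ⊗ pure n l'.
Proof.
elim: l m => [|v l IH] m <- //=.
rewrite tens_liftE ?IH ?tassocVE //; split=> [z a x y|w a x y] /=.
  by rewrite linear_tensorl tassocV_linear.
by rewrite tsplit_linear linear_tensorr tassocV_linear.
Qed.

Lemma ecast_linear m n (e : m = n) : linear (fun x => ecast l (tpow V l) e x).
Proof. by case: n / e. Qed.

Lemma ecast_pure m n (e : m = n) l : ecast l (tpow V l) e (pure m l) = pure n l.
Proof. by case: n / e. Qed.

Variable s : tens V V -> tens V V.
Hypothesis sl : linear s.

Lemma sigma_at_linear i n : linear (@sigma_at k V s i n).
Proof.
elim: n i => [|n IH] [|i] //=; last by apply: tmap_linear.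
by case: n {IH} => // n; apply: act12_linear.
Qed.

Lemma sigma_word_linear w n : linear (@sigma_word k V s w n).
Proof.
by elim: w => //= i w IH; apply: linear_comp => //; apply: sigma_at_linear.
Qed.

Lemma sigma_word_cat w1 w2 n (x : tpow V n) :
  sigma_word s (w1 ++ w2) x = sigma_word s w1 (sigma_word s w2 x).
Proof. by elim: w1 => //= i w1 ->. Qed.

Lemma sigma_at_pure n l1 u v l2 : size (l1 ++ u :: v :: l2) = n ->
  sigma_at s (size l1) (pure n (l1 ++ u :: v :: l2)) =
  \sum_(p <- braid_vv s u v) pure n (l1 ++ p.1 :: p.2 :: l2).
Proof.
elim: l1 n => [|x l1 IH] n <- /=; first by apply: act12E => //; apply: braid_vv_sum.
rewrite tmapE ?IH ?(lin_sum (linear_tensorr x)) //.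
exact: sigma_at_linear.
Qed.

(** The word i, i+1, .., i+n-1, read from the right of the reversed list, moves
    the factor number i past the n factors that follow it. *)
Lemma sigma_word_vl n l1 v l r : size (l1 ++ v :: l ++ r) = n ->
  sigma_word s (rev (iota (size l1) (size l))) (pure n (l1 ++ v :: l ++ r)) =
  \sum_(q <- braid_vl s v l) pure n (l1 ++ q.1 ++ q.2 :: r).
Proof.
elim: l l1 v => [|w l IH] l1 v nE.
  by rewrite (braid_vl_nil s v (fun x y => pure n (l1 ++ x ++ y :: r))).
rewrite (braid_vl_cons _ _ _ _ (fun x y => pure n (l1 ++ x ++ y :: r))).
rewrite /= rev_cons -cats1 sigma_word_cat /= sigma_at_pure //.
rewrite (lin_sum (@sigma_word_linear _ _)); apply: eq_bigr => p _.
have := IH (rcons l1 p.1) p.2; rewrite size_rcons cat_rcons => ->.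
  by apply: eq_bigr => q _; rewrite cat_rcons.
by rewrite -nE !size_cat /= !size_cat.
Qed.

(** The words for the vectors of [l] apply from right to left: the last vector
    of [l] moves first, as in the recursion for [braid_ll]. *)
Lemma sigma_word_ll n l1 l m r : size (l1 ++ l ++ m ++ r) = n ->
  sigma_word s (flatten [seq rev (iota p (size m)) | p <- iota (size l1) (size l)])
    (pure n (l1 ++ l ++ m ++ r)) =
  \sum_(q <- braid_ll s l m) pure n (l1 ++ q.1 ++ q.2 ++ r).
Proof.
elim: l l1 => [|v l IH] l1 nE.
  by rewrite (braid_ll_nil s _ (fun x y => pure n (l1 ++ x ++ y ++ r))).
rewrite (braid_ll_cons _ _ _ _ (fun x y => pure n (l1 ++ x ++ y ++ r))).
have := IH (rcons l1 v); rewrite size_rcons cat_rcons /= sigma_word_cat => -> //.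
rewrite (lin_sum (@sigma_word_linear _ _)).
rewrite big_seq [RHS]big_seq; apply: eq_bigr => q qb.
have [<- hq2] := size_braid_ll qb; rewrite cat_rcons sigma_word_vl //.
have [hq1 _] := size_braid_ll qb.
by rewrite -nE !size_cat /= !size_cat hq1 hq2 addnCA.
Qed.

Lemma beta_linear m n : linear (@beta k V s m n).
Proof.
apply: linear_comp (@tsplit_linear _ _) _.
apply: linear_comp (ecast_linear _) _.
apply: linear_comp (@sigma_word_linear _ _) _.
exact/tens_lift_linear/tcat_bilinear.
Qed.

Lemma beta_pure m n l l' : size l = m -> size l' = n ->
  beta s (pure m l ⊗ pure n l') =
  \sum_(q <- braid_ll s l l') pure n q.1 ⊗ pure m q.2.
Proof.
move=> lm ln; rewrite /beta tens_liftE; last exact: tcat_bilinear.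
rewrite tcat_pure // /chi_word -lm -ln -[l' in l ++ l']cats0.
rewrite (sigma_word_ll (l1 := [::])); last by rewrite /= cats0 size_cat.
rewrite (lin_sum (ecast_linear _)) (lin_sum (@tsplit_linear _ _)).
rewrite big_seq [RHS]big_seq; apply: eq_bigr => q qb.
by rewrite ecast_pure cat0s cats0 tsplit_pure // (size_braid_ll qb).1.
Qed.

End TensorPowers.

(** * Decorated trees span the free algebra *)

Lemma leaves_gt0 A :
  (forall T : tree A, (0 < leaves T)%N) /\ (forall B : branches A, (0 < bleaves B)%N).
Proof. by split=> [T|B]; rewrite ?(leaves_decos _).1 ?(leaves_decos _).2. Qed.

Section Decorations.
Variables (k : fieldType) (V : lmodType k).

(** The decorated tree of shape [S] with decorations [l]; by definition
    [dtree T] is [deco] of the shape and of the decorations of [T]. *)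
Definition deco (S : tree unit) (l : seq V) : Pbar V :=
  if l is v :: w then
    dsum_in (size w) (kD_basis k (size w).+1 S ⊗ tpure (v :: w))
  else 0.

Lemma decoE n S l : size l = n.+1 ->
  deco S l = dsum_in n (kD_basis k n.+1 S ⊗ pure n.+1 l).
Proof. by case: l => // v w [<-]; rewrite /deco tpureE. Qed.

Lemma i_VE v : i_V v = deco (Node Leaf tt (Last Leaf)) [:: v].
Proof. by []. Qed.

Lemma deco_mlin S : mlin (deco S).
Proof.
move=> l1 l2 a u v; pose n := (size l1 + size l2)%N.
have E x : size (l1 ++ x :: l2) = n.+1 by rewrite size_cat /= addnS.
rewrite !(decoE _ (E _)) pure_mlin; last by rewrite /n ltnS leq_addr.
by rewrite linear_tensorr dsum_in_linear.
Qed.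

(** The trivial tree is excluded, as it spans the summand of degree 0. *)
Definition fits (S : tree unit) (l : seq V) : Prop :=
  S <> Leaf /\ leaves S = (size l).+1.

Lemma fits_size S l : fits S l -> exists n, size l = n.+1.
Proof.
case: S => [[]//|S v B [_ /=]].
have := (leaves_gt0 _).1 S; have := (leaves_gt0 _).2 B.
case: l => [|x l] /=; [lia | by exists (size l)].
Qed.

Lemma Pbar_ind (P : Pbar V -> Prop) : subspace P ->
  (forall S l, fits S l -> P (deco S l)) -> forall x, P x.
Proof.
move=> sP PD f; have [r ->] := dsum_decomp f.
apply: subspace_sum => // n; move: (f n) => p {f r}.
have Dl : linear (fun q => dsum_in n q : Pbar V).
  by move=> a x y; rewrite dsum_in_linear.
rewrite (trepr_sum p) (lin_sum Dl); apply: subspace_sum => // -[t x] /=.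
have [r ->] := dsum_decomp t.
rewrite (lin_sum (linear_tensorl x)) (lin_sum Dl).
apply: subspace_sum => // T; move: (t T : k) => c {p t r}.
have -> : dsum_in T (c : k^o) = c *: kD_basis k n.+1 (val T).
  have [X /val_inj -> ->] := kD_basisE k (valP T).
  rewrite -(linZ (@dsum_in_linear _ _ (fun=> k^o) T)).
  by congr dsum_in; rewrite /GRing.scale /= mulr1.
rewrite (linZ (linear_tensorl x)) (linZ Dl); apply: subspaceZ => //.
move: x; apply: (@tpow_ind _ _ n.+1 (fun x => P (dsum_in n (_ ⊗ x)))).
  split=> [|a y z Py Pz]; last by rewrite linear_tensorr Dl; apply: sP.2.
  by rewrite (lin0 (linear_tensorr _)) (lin0 Dl); apply: sP.1.
move=> l ln; rewrite -decoE //; apply: PD; split; last by rewrite ln (eqP (valP T)).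
by move=> T0; have := valP T; rewrite T0.
Qed.

Lemma Pbar_op_deco op S l S' l' : fits S l -> fits S' l' ->
  Pbar_op op (deco S l) (deco S' l') = \sum_(U <- op S S') deco U (l ++ l').
Proof.
move=> gS gS'; have [m lm] := fits_size gS; have [n ln] := fits_size gS'.
rewrite (decoE _ lm) (decoE _ ln) Pbar_opE PV_opE kD_opE; last 2 first.
- by rewrite gS.2 lm.
- by rewrite gS'.2 ln.
rewrite tcat_pure // (lin_sum (linear_tensorl _)) (lin_sum (@dsum_in_linear _ _ _ _)).
by apply: eq_bigr => U _; rewrite -decoE // size_cat lm ln.
Qed.

Section SigmaAT.
Variable s : tens V V -> tens V V.
Hypothesis sl : linear s.

Let F m n (t : kD k m.+1) (x : tpow V m.+1) (t' : kD k n.+1) (x' : tpow V n.+1) :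
    tens (Pbar V) (Pbar V) :=
  tens_lift (fun y' y => dsum_in n (t' ⊗ y' : PV V n.+1) ⊗ dsum_in m (t ⊗ y : PV V m.+1))
    (beta s (x ⊗ x')).

Let in_linear m (t : kD k m.+1) : linear (fun y => dsum_in m (t ⊗ y : PV V m.+1) : Pbar V).
Proof. by move=> a x y; rewrite linear_tensorr dsum_in_linear. Qed.

Let in_bilinear m n (t : kD k m.+1) (t' : kD k n.+1) : is_bilinear (fun y' y =>
  (dsum_in n (t' ⊗ y' : PV V n.+1) : Pbar V) ⊗ (dsum_in m (t ⊗ y : PV V m.+1) : Pbar V)).
Proof. exact: (bilinear_tensor (@in_linear n t') (@in_linear m t)). Qed.

Let Fb1 m n t' x' : is_bilinear (fun t x => @F m n t x t' x').
Proof.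
split=> [x a t u|t a x y] /=; rewrite /F.
  rewrite -tens_lift_linf //; congr tens_lift; apply/funext=> y'; apply/funext=> y.
  by rewrite linear_tensorl dsum_in_linear linear_tensorr.
by rewrite linear_tensorl beta_linear // tens_lift_linear.
Qed.

Let Fb2 m n t x : is_bilinear (fun t' x' => @F m n t x t' x').
Proof.
split=> [x' a t' u|t' a x' y] /=; rewrite /F.
  rewrite -tens_lift_linf //; congr tens_lift; apply/funext=> y'; apply/funext=> y.
  by rewrite linear_tensorl dsum_in_linear linear_tensorl.
by rewrite linear_tensorr beta_linear // tens_lift_linear.
Qed.

Let Gb m n : is_bilinear (fun (p : PV V m.+1) (q : PV V n.+1) =>
  tens_lift (fun t x => tens_lift (@F m n t x) q) p).
Proof. exact: (tens_lift2_bilinear (@Fb1 m n) (@Fb2 m n)). Qed.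

Let Hb : is_bilinear (fun f g : Pbar V =>
  dsum_lift (fun m (p : PV V m.+1) => dsum_lift (fun n (q : PV V n.+1) =>
    tens_lift (fun t x => tens_lift (@F m n t x) q) p) g) f).
Proof. exact: (dsum_lift2_bilinear Gb). Qed.

Lemma sigmaAT_linear : linear (sigmaAT s).
Proof. exact: tens_lift_linear Hb. Qed.

Lemma sigmaAT_in m n (t : kD k m.+1) x (t' : kD k n.+1) x' :
  sigmaAT s (dsum_in m (t ⊗ x : PV V m.+1) ⊗ dsum_in n (t' ⊗ x' : PV V n.+1)) =
  F t x t' x'.
Proof.
rewrite /sigmaAT (tens_liftE _ _ Hb) dsum_liftE; last first.
  move=> i a p q; rewrite -dsum_lift_linf; try by move=> j; exact: (Gb i j).2.
  by congr dsum_lift; apply: functional_extensionality_dep => j; apply/funext => z;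
     exact: (Gb i j).1.
rewrite dsum_liftE; last by move=> j; exact: (Gb m j).2.
have tE y z : tens_lift (@F m n y z) (t' ⊗ x') = F y z t' x'.
  by rewrite tens_liftE //; apply: Fb2.
rewrite tens_liftE ?tE //; split=> [y a u v|u a y z] /=; rewrite !tE.
  exact: (@Fb1 m n t' x').1.
exact: (@Fb1 m n t' x').2.
Qed.

(** Both sides vanish if one of the lists is empty; otherwise the shapes are
    exchanged and [beta_pure] applies. *)
Lemma sigmaAT_deco S l S' l' : sigmaAT s (deco S l ⊗ deco S' l') =
  \sum_(p <- braid_ll s l l') deco S' p.1 ⊗ deco S p.2.
Proof.
have R0 : l = [::] \/ l' = [::] -> forall p, p \in braid_ll s l l' ->
    deco S' p.1 ⊗ deco S p.2 = 0.
  move=> ll p /size_braid_ll [h1 h2]; case: ll => ll; move: h1 h2; rewrite ll.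
    by case: p.2 => // _ _; rewrite (lin0 (linear_tensorr _)).
  by case: p.1 => // _ _; rewrite (lin0 (linear_tensorl _)).
have [l0|[v [w lE]]] : l = [::] \/ exists v w, l = v :: w.
    by case: l {R0} => [|v w]; [left|right; exists v, w].
  rewrite [RHS]big_seq big1; last by apply: R0; left.
  by rewrite l0 /= (lin0 (linear_tensorl _)) (lin0 sigmaAT_linear).
have [l0|[v' [w' lE']]] : l' = [::] \/ exists v w, l' = v :: w.
    by case: l' {R0} => [|v' w']; [left|right; exists v', w'].
  rewrite [RHS]big_seq big1; last by apply: R0; right.
  by rewrite l0 /= (lin0 (linear_tensorr _)) (lin0 sigmaAT_linear).
have lm : size l = (size w).+1 by rewrite lE.
have ln : size l' = (size w').+1 by rewrite lE'.
rewrite (decoE S lm) (decoE S' ln) sigmaAT_in /F beta_pure // tens_lift_sum //.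
rewrite big_seq [RHS]big_seq; apply: eq_bigr => p /size_braid_ll [h1 h2].
by rewrite -!decoE ?h1 ?h2.
Qed.

End SigmaAT.
End Decorations.

(** * The products of trees *)

Lemma star_neq_Leaf A (T T' U : tree A) :
  T <> Leaf -> T' <> Leaf -> U \in star T T' -> U <> Leaf.
Proof.
case: T => // ? ? ? _; case: T' => // ? ? ? _.
by rewrite starE // !mem_cat => /or3P[] /mapP[? _ ->].
Qed.

Section TreeProducts.
Variable A : Type.
Implicit Types (S T U x y z : tree A) (B C : branches A).

Lemma bstar_bcat C v B T :
  bstar (bcat C v B) T = [seq bcat C v D | D <- bstar B T].
Proof. by elim: C => //= T0 w C ->; rewrite -map_comp. Qed.

Lemma bcatA B v C w D : bcat (bcat B v C) w D = bcat B v (bcat C w D).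
Proof. by elim: B => //= T0 u B ->. Qed.

Variable M : nmodType.

Lemma sum_prec T0 v B T (G : tree A -> M) :
  \sum_(U <- tree_prec (Node T0 v B) T) G U = \sum_(C <- bstar B T) G (Node T0 v C).
Proof. by rewrite /tree_prec big_map. Qed.

Lemma sum_succ T T0 v B (G : tree A -> M) :
  \sum_(U <- tree_succ T (Node T0 v B)) G U = \sum_(U <- star T T0) G (Node U v B).
Proof. by rewrite /tree_succ big_map. Qed.

Lemma sum_dot T0 v B T0' v' B' (G : tree A -> M) :
  \sum_(U <- tree_dot (Node T0 v B) (Node T0' v' B')) G U =
  \sum_(C <- bstar B T0') G (Node T0 v (bcat C v' B')).
Proof. by rewrite /tree_dot big_map. Qed.

Lemma sum_star T T' (G : tree A -> M) : T <> Leaf -> T' <> Leaf ->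
  \sum_(U <- star T T') G U = \sum_(U <- tree_prec T T') G U +
    \sum_(U <- tree_succ T T') G U + \sum_(U <- tree_dot T T') G U.
Proof. by move=> T0 T0'; rewrite starE // !big_cat /= addrA. Qed.

Lemma tree_succ_prec x y z (G : tree A -> M) : y <> Leaf ->
  \sum_(U <- tree_succ x y) \sum_(W <- tree_prec U z) G W =
  \sum_(U <- tree_prec y z) \sum_(W <- tree_succ x U) G W.
Proof.
case: y => // T0 v B _; rewrite sum_succ sum_prec.
under eq_bigr => U _ do rewrite sum_prec.
under [RHS]eq_bigr => C _ do rewrite sum_succ.
exact: exchange_big.
Qed.

Lemma tree_dot_prec x y z (G : tree A -> M) : x <> Leaf -> y <> Leaf ->
  \sum_(U <- tree_dot x y) \sum_(W <- tree_prec U z) G W =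
  \sum_(U <- tree_prec y z) \sum_(W <- tree_dot x U) G W.
Proof.
case: x => // S0 u C _; case: y => // T0 v B _; rewrite sum_dot sum_prec.
under eq_bigr => D _ do rewrite sum_prec bstar_bcat big_map.
under [RHS]eq_bigr => D _ do rewrite sum_dot.
exact: exchange_big.
Qed.

Lemma tree_succ_dot x y z (G : tree A -> M) : y <> Leaf -> z <> Leaf ->
  \sum_(U <- tree_succ x y) \sum_(W <- tree_dot U z) G W =
  \sum_(U <- tree_dot y z) \sum_(W <- tree_succ x U) G W.
Proof.
case: y => // S0 u C _; case: z => // T0 v B _; rewrite sum_succ sum_dot.
under eq_bigr => U _ do rewrite sum_dot.
under [RHS]eq_bigr => D _ do rewrite sum_succ.
exact: exchange_big.
Qed.

Lemma tree_dot_dot x y z (G : tree A -> M) :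
  x <> Leaf -> y <> Leaf -> z <> Leaf ->
  \sum_(U <- tree_dot x y) \sum_(W <- tree_dot U z) G W =
  \sum_(U <- tree_dot y z) \sum_(W <- tree_dot x U) G W.
Proof.
case: x => // R0 t D _; case: y => // S0 u C _; case: z => // T0 v B _.
rewrite !sum_dot.
under eq_bigr => U _ do rewrite sum_dot bstar_bcat big_map.
under [RHS]eq_bigr => U _ do rewrite sum_dot.
rewrite exchange_big; apply: eq_bigr => U _; apply: eq_bigr => W _.
by rewrite bcatA.
Qed.

(** Associativity for the products that graft a tree onto the last branch of a
    root; the axioms for prec after prec and for dot after prec reduce to it. *)
Definition bstar_assoc_at B : Prop := forall y z (G : branches A -> M),
  \sum_(C <- bstar B y) \sum_(D <- bstar C z) G D =
  \sum_(U <- star y z) \sum_(D <- bstar B U) G D.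

Lemma tree_prec_prec T0 v B y z (G : tree A -> M) : bstar_assoc_at B ->
  \sum_(U <- tree_prec (Node T0 v B) y) \sum_(W <- tree_prec U z) G W =
  \sum_(U <- star y z) \sum_(W <- tree_prec (Node T0 v B) U) G W.
Proof.
move=> IB; rewrite sum_prec; under eq_bigr => U _ do rewrite sum_prec.
rewrite (IB _ _ (fun C => G (Node T0 v C))).
by apply: eq_bigr => U _; rewrite sum_prec.
Qed.

Lemma tree_prec_dot T0 v B y z (G : tree A -> M) : bstar_assoc_at B -> z <> Leaf ->
  \sum_(U <- tree_prec (Node T0 v B) y) \sum_(W <- tree_dot U z) G W =
  \sum_(U <- tree_succ y z) \sum_(W <- tree_dot (Node T0 v B) U) G W.
Proof.
case: z => // R0 w D IB _.
rewrite sum_prec sum_succ; under eq_bigr => U _ do rewrite sum_dot.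
rewrite (IB _ _ (fun C => G (Node T0 v (bcat C w D)))).
by apply: eq_bigr => U _; rewrite sum_dot.
Qed.

Lemma tree_succ_succ x y R0 w D (G : tree A -> M) :
  (forall G : tree A -> M, \sum_(U <- star x y) \sum_(W <- star U R0) G W =
    \sum_(U <- star y R0) \sum_(W <- star x U) G W) ->
  \sum_(U <- star x y) \sum_(W <- tree_succ U (Node R0 w D)) G W =
  \sum_(U <- tree_succ y (Node R0 w D)) \sum_(W <- tree_succ x U) G W.
Proof.
move=> IR; rewrite sum_succ; under eq_bigr => U _ do rewrite sum_succ.
rewrite (IR (fun W => G (Node W w D))).
by apply: eq_bigr => U _; rewrite sum_succ.
Qed.

(** Expanding both products * into three parts turns associativity for three
    nontrivial trees into the sum of the seven tridendriform axioms. The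
    hypotheses of the three axioms that need some are the induction hypotheses
    on the last branches of the first tree and on the first branch of the third
    one. *)
Lemma star_assoc :
  (forall x y z (G : tree A -> M),
    \sum_(U <- star x y) \sum_(W <- star U z) G W =
    \sum_(U <- star y z) \sum_(W <- star x U) G W) /\
  (forall B, bstar_assoc_at B).
Proof.
apply: tree_mutind => [y z G|T0 _ v B IB|T IT y z G|T _ v C IC y z G].
- rewrite star0T big_seq1; apply: eq_bigr => U _.
  by rewrite star0T big_seq1.
- case=> [|S0 u C] z G.
    by rewrite star0T starT0 !big_seq1.
  elim: z G => [|R0 IR w D] G.
    by rewrite starT0 big_seq1; apply: eq_bigr => U _; rewrite starT0 big_seq1.
  set x := Node T0 v B; set y := Node S0 u C; set z := Node R0 w D.
  have x0 : x <> Leaf by []. have y0 : y <> Leaf by []. have z0 : z <> Leaf by [].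
  transitivity (\sum_(U <- star x y) (\sum_(W <- tree_prec U z) G W +
      \sum_(W <- tree_succ U z) G W + \sum_(W <- tree_dot U z) G W)).
    rewrite [LHS]big_seq [RHS]big_seq; apply: eq_bigr => U Uxy.
    by rewrite sum_star //; apply: star_neq_Leaf Uxy.
  transitivity (\sum_(U <- star y z) (\sum_(W <- tree_prec x U) G W +
      \sum_(W <- tree_succ x U) G W + \sum_(W <- tree_dot x U) G W)); last first.
    rewrite [LHS]big_seq [RHS]big_seq; apply: eq_bigr => U Uyz.
    by rewrite [RHS]sum_star //; apply: star_neq_Leaf Uyz.
  rewrite !big_split /= (tree_succ_succ _ _ _ IR) -(tree_prec_prec T0 v y z G IB) -/x.
  rewrite !(sum_star _ x0 y0) !(sum_star _ y0 z0).
  rewrite (tree_prec_dot T0 v y G IB z0) tree_succ_prec // tree_dot_prec //.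
  rewrite tree_succ_dot // tree_dot_dot // !addrA; congr (_ + _).
  (* The two sides group the remaining six sums by the outer and by the inner
     product. *)
  by rewrite [LHS](ACl (1*2*4*6*3*5))%AC.
- rewrite /= big_map; under eq_bigr => U _ do rewrite /= big_map.
  by rewrite IT; apply: eq_bigr => U _; rewrite big_map.
- rewrite /= big_map; under eq_bigr => U _ do rewrite /= big_map.
  by rewrite IC; apply: eq_bigr => U _; rewrite big_map.
Qed.

End TreeProducts.

(** * The braided tridendriform algebra of decorated trees *)

Section PbarAlgebra.
Variables (k : fieldType) (V : lmodType k).

(** Common property of *, prec, succ and dot. It ensures that the angles of every
    term of [op S S'] are those of [S] followed by those of [S']. *)
Definition substar (op : tree unit -> tree unit -> seq (tree unit)) : Prop :=
  forall S S', S <> Leaf -> S' <> Leaf -> {subset op S S' <= star S S'}.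

Lemma substar_star : substar (@star unit).
Proof. by move=> S S' _ _ U. Qed.

Lemma substar_prec : substar (@tree_prec unit).
Proof. by move=> S S' S0 S0' U h; rewrite starE // !mem_cat h. Qed.

Lemma substar_succ : substar (@tree_succ unit).
Proof. by move=> S S' S0 S0' U h; rewrite starE // !mem_cat h orbT. Qed.

Lemma substar_dot : substar (@tree_dot unit).
Proof. by move=> S S' S0 S0' U h; rewrite starE // !mem_cat h !orbT. Qed.

Lemma fits_op op S (l : seq V) S' l' U : substar op ->
  fits S l -> fits S' l' -> U \in op S S' -> fits U (l ++ l').
Proof.
move=> sop [S0 Sl] [S0' Sl'] /(sop _ _ S0 S0') UP.
split; first exact: star_neq_Leaf UP.
move: Sl Sl'; rewrite !(leaves_decos _).1 ((mem_star_decos _).1 _ _ _ UP).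
by rewrite !size_cat => -[->] [->].
Qed.

Lemma fits_size_eq S (l l' : seq V) : size l = size l' -> fits S l -> fits S l'.
Proof. by rewrite /fits => ->. Qed.

(** Common form of the seven axioms: an identity between sums of shapes gives
    one in the free algebra, since concatenation of decorations is
    associative. *)
Lemma Pbar_assoc o1 o2 o3 o4 : substar o2 -> substar o4 ->
  (forall x y z (G : tree unit -> Pbar V), x <> Leaf -> y <> Leaf -> z <> Leaf ->
    \sum_(U <- o2 x y) \sum_(W <- o1 U z) G W =
    \sum_(U <- o4 y z) \sum_(W <- o3 x U) G W) ->
  forall x y z : Pbar V,
    Pbar_op o1 (Pbar_op o2 x y) z = Pbar_op o3 x (Pbar_op o4 y z).
Proof.
move=> so2 so4 o1234 x y z.
have opl o := (@Pbar_op_bilinear _ V o).1; have opr o := (@Pbar_op_bilinear _ V o).2.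
move: x; apply: Pbar_ind => [|S l gl].
  apply: subspace_eq (opl o3 _); exact: linear_comp (opl o1 z) (opl o2 y).
move: y; apply: Pbar_ind => [|S' m gm].
  apply: subspace_eq; first exact: linear_comp (opl o1 z) (opr o2 _).
  exact: linear_comp (opr o3 _) (opl o4 z).
move: z; apply: Pbar_ind => [|S'' n gn].
  apply: (subspace_eq (opr o1 _)); exact: linear_comp (opr o3 _) (opr o4 _).
rewrite !Pbar_op_deco // (lin_sum (opl o1 _)) (lin_sum (opr o3 _)).
transitivity (\sum_(U <- o2 S S') \sum_(W <- o1 U S'') deco W (l ++ m ++ n)).
  rewrite big_seq [RHS]big_seq; apply: eq_bigr => U /(fits_op so2 gl gm) gU.
  by rewrite Pbar_op_deco // catA.
rewrite (o1234 _ _ _ _ gl.1 gm.1 gn.1).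
rewrite big_seq [RHS]big_seq; apply: eq_bigr => U /(fits_op so4 gm gn) gU.
by rewrite Pbar_op_deco.
Qed.

Lemma Pbar_star (x y : Pbar V) :
  Pbar_prec x y + Pbar_succ x y + Pbar_dot x y = Pbar_op (@star unit) x y.
Proof.
have opl o := (@Pbar_op_bilinear _ V o).1; have opr o := (@Pbar_op_bilinear _ V o).2.
move: x; apply: Pbar_ind => [|S l gl].
  by apply: subspace_eq (opl _ y); apply: linear_D (opl _ y); apply: linear_D; apply: opl.
move: y; apply: Pbar_ind => [|S' m gm].
  by apply: subspace_eq (opr _ _); apply: linear_D (opr _ _); apply: linear_D; apply: opr.
rewrite /Pbar_prec /Pbar_succ /Pbar_dot !Pbar_op_deco //.
by rewrite sum_star //; [apply: gl.1 | apply: gm.1].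
Qed.

Lemma Pbar_tridendriform :
  is_tridendriform (@Pbar_prec k V) (@Pbar_succ k V) (@Pbar_dot k V).
Proof.
have [sS sp ss sd] := And4 substar_star substar_prec substar_succ substar_dot.
split; [exact: Pbar_op_bilinear | exact: Pbar_op_bilinear
  | exact: Pbar_op_bilinear | | | | | | |]; move=> x y z; rewrite ?Pbar_star.
- apply: Pbar_assoc => // -[//|T0 v B] y' z' G _ _ _.
  by apply: tree_prec_prec; apply: (star_assoc _ _).2.
- by apply: Pbar_assoc => // *; apply: tree_succ_prec.
- symmetry; apply: Pbar_assoc => // x' y' [//|R0 w D] G _ _ _.
  by apply: tree_succ_succ; apply: (star_assoc _ _).1.
- by apply: Pbar_assoc => // *; apply: tree_dot_prec.
- apply: Pbar_assoc => // -[//|T0 v B] y' z' G _ _ z0.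
  by apply: tree_prec_dot => //; apply: (star_assoc _ _).2.
- by apply: Pbar_assoc => // *; apply: tree_succ_dot.
- by apply: Pbar_assoc => // *; apply: tree_dot_dot.
Qed.

Lemma Pbar3_unique (M : lmodType k)
    (g h : tens (Pbar V) (tens (Pbar V) (Pbar V)) -> M) :
  linear g -> linear h ->
  (forall S l S' l' S'' l'', fits S l -> fits S' l' -> fits S'' l'' ->
    g (deco S l ⊗ (deco S' l' ⊗ deco S'' l'')) =
    h (deco S l ⊗ (deco S' l' ⊗ deco S'' l''))) -> g =1 h.
Proof.
move=> gl hl gh; apply: tens3_unique => // x y z.
move: x; apply: Pbar_ind => [|S l gS].
  by apply: subspace_eq => a u v; rewrite linear_tensorl ?gl ?hl.
move: y; apply: Pbar_ind => [|S' l' gS'].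
  by apply: subspace_eq => a u v; rewrite linear_tensorl linear_tensorr ?gl ?hl.
move: z; apply: Pbar_ind => [|S'' l'' gS'']; last exact: gh.
by apply: subspace_eq => a u v; rewrite !linear_tensorr ?gl ?hl.
Qed.

Variable s : tens V V -> tens V V.
Hypothesis sb : is_braiding s.
Let sl : linear s := sb.1.
Let sATl := sigmaAT_linear sl.

Let D (a : tree unit * seq V) : Pbar V := deco a.1 a.2.
Let r (a b : tree unit * seq V) :=
  [seq ((b.1, p.1), (a.1, p.2)) | p <- braid_ll s a.2 b.2].

Let sD a b : sigmaAT s (D a ⊗ D b) = \sum_(p <- r a b) D p.1 ⊗ D p.2.
Proof. by rewrite big_map; apply: sigmaAT_deco. Qed.

(** [sigma121D] and [sigma212D] reduce the braid relation to the one for lists,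
    applied to a function that is multilinear in the decorations. *)
Lemma sigmaAT_braiding : is_braiding (sigmaAT s).
Proof.
split; first exact: sATl.
have l1 := sigma1_linear sATl; have l2 := sigma2_linear sATl.
apply: Pbar3_unique => [||S l S' m S'' n _ _ _].
- exact: linear_comp l1 (linear_comp l2 l1).
- exact: linear_comp l2 (linear_comp l1 l2).
have E1 := sigma121D sATl sD (S, l) (S', m) (S'', n).
have E2 := sigma212D sATl sD (S, l) (S', m) (S'', n).
rewrite /D /= in E1 E2; rewrite E1 E2 /r !big_map /=.
under eq_bigr => p _ do
  (rewrite big_map /=; under eq_bigr => q _ do rewrite big_map /=).
under [RHS]eq_bigr => p _ do
  (rewrite big_map /=; under eq_bigr => q _ do rewrite big_map /=).
apply: (yang_baxter_lll sb (G := fun x y z => deco S'' x ⊗ (deco S' y ⊗ deco S z))).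
- by move=> y z l1' l2' a u v; rewrite deco_mlin linear_tensorl.
- by move=> x z l1' l2' a u v; rewrite deco_mlin linear_tensorl linear_tensorr.
- by move=> x y l1' l2' a u v; rewrite deco_mlin !linear_tensorr.
Qed.

(** The shape of the product does not interact with the braiding and its
    decorations are a concatenation, so these are [braid_ll_catr] and
    [braid_ll_catl]. *)
Lemma sigmaAT_compat op : substar op -> braiding_compat (sigmaAT s) (@Pbar_op k V op).
Proof.
move=> sop; have ob := @Pbar_op_bilinear _ V op; have ol := tens_lift_linear ob.
have l1 := sigma1_linear sATl; have l2 := sigma2_linear sATl.
have li := @linear_idfun _ (Pbar V).
have Va := @tassocV_linear _ (Pbar V) (Pbar V) (Pbar V).
split; apply: Pbar3_unique => [||S l S' m S'' n gS gS' gS''].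
- exact: linear_comp sATl (tmap_linear li ol).
- exact: linear_comp (tmap_linear ol li) (linear_comp Va (linear_comp l2 l1)).
- rewrite (hexagonrE sATl ob (sigmaAT_deco sl S l S' m)
    (fun p => sigmaAT_deco sl S p.2 S'' n)).
  rewrite tmap_opr // Pbar_op_deco // (lin_sum (linear_tensorr _)) (lin_sum sATl).
  transitivity (\sum_(p <- braid_ll s l m) \sum_(q <- braid_ll s p.2 n) \sum_(U <- op S' S'')
      deco U (p.1 ++ q.1) ⊗ deco S q.2); last first.
    rewrite big_seq [RHS]big_seq; apply: eq_bigr => p /size_braid_ll[p1 p2].
    rewrite big_seq [RHS]big_seq; apply: eq_bigr => q /size_braid_ll[q1 q2].
    rewrite Pbar_op_deco ?(lin_sum (linear_tensorl _)) //.
      exact: fits_size_eq gS'.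
    exact: fits_size_eq gS''.
  under [RHS]eq_bigr => p _ do rewrite exchange_big /=.
  rewrite [RHS]exchange_big; apply: eq_bigr => U _ /=.
  by rewrite sigmaAT_deco // (braid_ll_catr _ _ _ _ (fun x y => deco U x ⊗ deco S y)).
- exact: linear_comp sATl (linear_comp (tmap_linear ol li) Va).
- exact: linear_comp (tmap_linear li ol) (linear_comp l1 l2).
- rewrite (hexagonlE sATl ob (sigmaAT_deco sl S' m S'' n)
    (fun p => sigmaAT_deco sl S l S'' p.1)).
  rewrite tmap_opl // Pbar_op_deco // (lin_sum (linear_tensorl _)) (lin_sum sATl).
  transitivity (\sum_(p <- braid_ll s m n) \sum_(q <- braid_ll s l p.1) \sum_(U <- op S S')
      deco S'' q.1 ⊗ deco U (q.2 ++ p.2)); last first.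
    rewrite big_seq [RHS]big_seq; apply: eq_bigr => p /size_braid_ll[p1 p2].
    rewrite big_seq [RHS]big_seq; apply: eq_bigr => q /size_braid_ll[q1 q2].
    rewrite Pbar_op_deco ?(lin_sum (linear_tensorr _)) //.
      exact: fits_size_eq gS.
    exact: fits_size_eq gS'.
  under [RHS]eq_bigr => p _ do rewrite exchange_big /=.
  rewrite [RHS]exchange_big; apply: eq_bigr => U _ /=.
  by rewrite sigmaAT_deco // (braid_ll_catl _ _ _ _ (fun x y => deco S'' x ⊗ deco U y)).
Qed.

Lemma Pbar_braided_tridendriform : is_braided_tridendriform
  (@Pbar_prec k V) (@Pbar_succ k V) (@Pbar_dot k V) (sigmaAT s).
Proof.
split; first exact: Pbar_tridendriform.
- exact: sigmaAT_braiding.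
- exact/sigmaAT_compat/substar_prec.
- exact/sigmaAT_compat/substar_succ.
- exact/sigmaAT_compat/substar_dot.
Qed.

Lemma i_V_linear : linear (@i_V k V).
Proof.
by move=> a u v; rewrite !i_VE; apply: (deco_mlin (Node Leaf tt (Last Leaf)) [::] [::]).
Qed.

Lemma sigmaAT_i_V u v : sigmaAT s (i_V u ⊗ i_V v) =
  \sum_(p <- braid_vv s u v) i_V p.1 ⊗ i_V p.2.
Proof.
pose N : tree unit := Node Leaf tt (Last Leaf).
rewrite !i_VE sigmaAT_deco // (braid_ll_cons _ _ _ _ (fun x y => deco N x ⊗ deco N y)).
rewrite (braid_ll_nil _ _ (fun x y =>
  \sum_(q <- braid_vl s u x) deco N q.1 ⊗ deco N (q.2 :: y))).
rewrite (braid_vl_cons _ _ _ _ (fun x y => deco N x ⊗ deco N [:: y])).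
apply: eq_bigr => p _.
by rewrite (braid_vl_nil _ _ (fun x y => deco N (p.1 :: x) ⊗ deco N [:: y])).
Qed.

Lemma i_V_braided_hom : is_braided_hom s (sigmaAT s) (@i_V k V).
Proof.
have il := i_V_linear; have tl := tmap_linear il il.
split=> //; apply: tens_lift_unique => [||u v].
- exact: linear_comp tl sl.
- exact: linear_comp sATl tl.
rewrite tmapE // sigmaAT_i_V (braid_vv_sum s) (lin_sum tl).
by apply: eq_bigr => p _; rewrite tmapE.
Qed.

End PbarAlgebra.

(** * Evaluating decorated trees in a tridendriform algebra *)

Lemma leaves_star A (T T' U : tree A) : U \in star T T' ->
  leaves U = (leaves T + leaves T').-1.
Proof.
move=> /((mem_star_decos _).1 _ _ _); rewrite !(leaves_decos _).1 => ->.
by rewrite size_cat; lia.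
Qed.

Lemma split_seq A (l : seq A) n m :
  (0 < n)%N -> (0 < m)%N -> (n + m)%N = (size l).+1 ->
  exists l0 x l1, [/\ l = l0 ++ x :: l1, n = (size l0).+1 & m = (size l1).+1].
Proof.
case: n => // n _; case: m => // m _ E.
have nl : (n < size l)%N by lia.
case: l nl E => // x0 l nl E.
exists (take n (x0 :: l)), (nth x0 (x0 :: l) n), (drop n.+1 (x0 :: l)).
split; first by rewrite -drop_nth // cat_take_drop.
  by rewrite size_take nl.
by rewrite size_drop; lia.
Qed.

Section Evaluation.
Variables (k : fieldType) (V R : lmodType k) (prec succ dot : R -> R -> R).
Hypothesis tdR : is_tridendriform prec succ dot.
Variable phi : V -> R.
Hypothesis phil : linear phi.

(** Products whose factor indexed by [T] is the unit when [T] is trivial. *)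
Definition precU (T : tree unit) (x y : R) : R := if T is Leaf then x else prec x y.
Definition succU (T : tree unit) (x y : R) : R := if T is Leaf then y else succ x y.

(** The value forced by T_0 \/_v T_1 = (T_0 > T[v]) < T_1 and
    T_0 \/_v T_1 \/_w .. = (T_0 > T[v]) . (T_1 \/_w ..). In [evB B r l] the
    argument [r] is the value of T_0 > T[v], that is, of everything on the left
    of [B]. The trivial tree stands for a unit, which R lacks: it is handled by
    [precU] and [succU], and 0 is a placeholder. *)
Fixpoint ev (T : tree unit) (l : seq V) : R :=
  match T with
  | Leaf => 0
  | Node T0 _ B => let n := (leaves T0).-1 in
      evB B (succU T0 (ev T0 (take n l)) (phi (nth 0 l n))) (drop n.+1 l)
  end
with evB (B : branches unit) (r : R) (l : seq V) : R :=
  match B with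
  | Last T => precU T r (ev T l)
  | Defs.Cons T _ C => let n := (leaves T).-1 in
      dot r (evB C (succU T (ev T (take n l)) (phi (nth 0 l n))) (drop n.+1 l))
  end.

Lemma take_nth_drop n l0 (x : V) l1 : n = (size l0).+1 ->
  [/\ take n.-1 (l0 ++ x :: l1) = l0, nth 0 (l0 ++ x :: l1) n.-1 = x &
      drop n.-1.+1 (l0 ++ x :: l1) = l1].
Proof.
move=> ->; split=> /=; first exact: take_size_cat.
  by rewrite nth_cat ltnn subnn.
by rewrite drop_cat ltnNge leqnSn /= subSnn /= drop0.
Qed.

Lemma ev_Node T0 v B l0 x l1 : leaves T0 = (size l0).+1 ->
  ev (Node T0 v B) (l0 ++ x :: l1) = evB B (succU T0 (ev T0 l0) (phi x)) l1.
Proof. by move=> /(@take_nth_drop _ _ x l1) [E1 E2 E3] /=; rewrite E1 E2 E3. Qed.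

Lemma evB_Cons T v C r l0 x l1 : leaves T = (size l0).+1 ->
  evB (Defs.Cons T v C) r (l0 ++ x :: l1) =
  dot r (evB C (succU T (ev T l0) (phi x)) l1).
Proof. by move=> /(@take_nth_drop _ _ x l1) [E1 E2 E3] /=; rewrite E1 E2 E3. Qed.

Let precl y : linear (prec^~ y) := (td_precB tdR).1 y.
Let precr x : linear (prec x) := (td_precB tdR).2 x.
Let succl y : linear (succ^~ y) := (td_succB tdR).1 y.
Let succr x : linear (succ x) := (td_succB tdR).2 x.
Let dotl y : linear (dot^~ y) := (td_dotB tdR).1 y.
Let dotr x : linear (dot x) := (td_dotB tdR).2 x.

Lemma succU_linear T x : linear (succU T x).
Proof. by case: T. Qed.

Lemma evB_linear B l : linear (fun r => evB B r l).
Proof. by case: B => [[|T0 v B]|T v C] //=. Qed.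

(** A left factor moves out of the whole tree because it only meets the value
    at the left end of the root. *)
Lemma evB_succ B x y l : evB B (succ x y) l = succ x (evB B y l).
Proof.
by case: B => [[|T0 v B]|T v C] //=; [apply: (td_sp tdR) | apply: (td_sd tdR)].
Qed.

(** Evaluation is multiplicative, by the same induction as [star_assoc]. The
    products of branches enter with an arbitrary value [r] on their left; the
    two statements about them correspond to multiplying on the right by a tree
    for prec and for dot. *)
Lemma ev_star :
  (forall (S S' : tree unit) l l',
    leaves S = (size l).+1 -> leaves S' = (size l').+1 ->
    [/\ forall r, \sum_(U <- star S S') precU U r (ev U (l ++ l')) =
          precU S' (precU S r (ev S l)) (ev S' l'),
        forall y, \sum_(U <- star S S') succU U (ev U (l ++ l')) y =
          succU S (ev S l) (succU S' (ev S' l') y) &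
        S <> Leaf -> S' <> Leaf ->
        [/\ \sum_(U <- tree_prec S S') ev U (l ++ l') = prec (ev S l) (ev S' l'),
            \sum_(U <- tree_succ S S') ev U (l ++ l') = succ (ev S l) (ev S' l') &
            \sum_(U <- tree_dot S S') ev U (l ++ l') = dot (ev S l) (ev S' l')]]) /\
  (forall (B : branches unit) S' l l' r,
    bleaves B = (size l).+1 -> leaves S' = (size l').+1 ->
    \sum_(C <- bstar B S') evB C r (l ++ l') = precU S' (evB B r l) (ev S' l') /\
    forall v B' x l1, \sum_(C <- bstar B S') evB (bcat C v B') r (l ++ l' ++ x :: l1) =
      dot (evB B r l) (evB B' (succU S' (ev S' l') (phi x)) l1)).
Proof.
apply: tree_mutind => [S' [|//] l' _ hS'|S0 _ v B IB
  |T IT S' l l' r hl hl'|T _ v C IC S' l l' r hl hl'].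
- by rewrite star0T; split=> [r|y|//]; rewrite big_seq1.
- elim=> [l [|//] hl _|S0' IS' v' B' l l' hl hl'].
    by rewrite cats0 starT0; split=> [r|y|_ []//]; rewrite big_seq1.
  set S := Node S0 v B; set S' := Node S0' v' B'.
  have [l0 [x [l1 [lE hl0 hl1]]]] :=
    split_seq ((leaves_gt0 _).1 S0) ((leaves_gt0 _).2 B) hl.
  have [l0' [x' [l1' [lE' hl0' hl1']]]] :=
    split_seq ((leaves_gt0 _).1 S0') ((leaves_gt0 _).2 B') hl'.
  have [_ IS0' _] := IS' _ _ hl hl0'.
  have evS : ev S l = evB B (succU S0 (ev S0 l0) (phi x)) l1 by rewrite lE ev_Node.
  have evS' : ev S' l' = evB B' (succU S0' (ev S0' l0') (phi x')) l1'.
    by rewrite lE' ev_Node.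
  have Hprec : \sum_(U <- tree_prec S S') ev U (l ++ l') = prec (ev S l) (ev S' l').
    rewrite sum_prec lE -catA cat_cons -lE evS.
    rewrite -[RHS](IB S' l1 l' (succU S0 (ev S0 l0) (phi x)) hl1 hl').1.
    by apply: eq_bigr => C _; rewrite ev_Node.
  have Hsucc : \sum_(U <- tree_succ S S') ev U (l ++ l') = succ (ev S l) (ev S' l').
    rewrite sum_succ evS' lE' catA -evB_succ.
    rewrite -[succ _ _](IS0' (phi x')) (lin_sum (@evB_linear _ _)).
    rewrite big_seq [RHS]big_seq; apply: eq_bigr => U /leaves_star UE.
    by rewrite ev_Node // UE hl hl0' size_cat; lia.
  have Hdot : \sum_(U <- tree_dot S S') ev U (l ++ l') = dot (ev S l) (ev S' l').
    rewrite sum_dot evS' evS.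
    rewrite -((IB S0' l1 l0' _ hl1 hl0').2 v' B' x' l1') lE lE' -catA cat_cons.
    by apply: eq_bigr => C _; rewrite ev_Node.
  have H : \sum_(U <- star S S') ev U (l ++ l') =
      prec (ev S l) (ev S' l') + succ (ev S l) (ev S' l') + dot (ev S l) (ev S' l').
    by rewrite sum_star // Hprec Hsucc Hdot.
  split=> [r|y|_ _]; last by split.
    rewrite [RHS](td_pp tdR) -H (lin_sum (precr r)) big_seq [RHS]big_seq.
    by apply: eq_bigr => -[|? ? ?] // /star_neq_Leaf h; case: h.
  rewrite [RHS](td_ss tdR) -H (lin_sum (succl y)) big_seq [RHS]big_seq.
  by apply: eq_bigr => -[|? ? ?] // /star_neq_Leaf h; case: h.
- have [H1 H2 _] := IT S' l l' hl hl'.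
  split=> [|v B' x l1]; first by rewrite /= big_map H1.
  rewrite [bstar _ _]/= big_map.
  transitivity (\sum_(U <- star T S') dot r (evB B' (succU U (ev U (l ++ l')) (phi x)) l1)).
    rewrite big_seq [RHS]big_seq; apply: eq_bigr => U /leaves_star UE.
    rewrite [bcat _ _ _]/= catA evB_Cons // UE size_cat hl'.
    by rewrite [leaves T]hl; lia.
  rewrite -(lin_sum (dotr r)) -(lin_sum (@evB_linear B' l1)) H2.
  case: T {IT H1 H2 hl} => [//|T0 w B].
  by rewrite [succU (Node T0 w B) _ _]/= evB_succ -(td_pd tdR).
- have [l0 [y [l1 [lE hl0 hl1]]]] :=
    split_seq ((leaves_gt0 _).1 T) ((leaves_gt0 _).2 C) hl.
  have [H1 H2] := IC S' l1 l' (succU T (ev T l0) (phi y)) hl1 hl'.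
  rewrite lE (evB_Cons _ _ _ _ _ hl0); split=> [|v' B' x l2].
    rewrite [bstar _ _]/= big_map -catA cat_cons.
    under eq_bigr => D _ do rewrite (evB_Cons _ _ _ _ _ hl0).
    rewrite -(lin_sum (dotr r)) H1.
    by case: S' {hl' H1 H2} => //= T0 w B; rewrite (td_dp tdR).
  rewrite [bstar _ _]/= big_map -catA cat_cons.
  under eq_bigr => D _ do rewrite [bcat _ _ _]/= (evB_Cons _ _ _ _ _ hl0).
  by rewrite -(lin_sum (dotr r)) H2 (td_dd tdR).
Qed.

(** Evaluation of a shape ignores the entries of a list that is too long, so
    its linearity has to be restricted to lists of the right length [n]. *)
Definition mlin_on n (F : seq V -> R) : Prop := forall (l1 l2 : seq V) a (u v : V),
  (size l1 + size l2).+1 = n ->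
  F (l1 ++ (a *: u + v) :: l2) = a *: F (l1 ++ u :: l2) + F (l1 ++ v :: l2).

(** The entry that varies lies in the left part, at the cut, or in the right
    part. Here [n] and [m] count leaves, one more than the number of entries. *)
Lemma mlin_split n m (K : seq V -> V -> seq V -> R) (F : seq V -> R) :
  (forall l0 x l1, n = (size l0).+1 -> F (l0 ++ x :: l1) = K l0 x l1) ->
  (forall x l1, mlin_on n.-1 (fun l0 => K l0 x l1)) ->
  (forall l0 l1, linear (fun x => K l0 x l1)) ->
  (forall l0 x, mlin_on m.-1 (K l0 x)) ->
  (0 < n)%N -> (0 < m)%N -> mlin_on (n + m).-1 F.
Proof.
move=> FK K1 K2 K3 n0 m0 l1 l2 a u v E.
have [E1|E1|E1] := ltngtP (size l1).+1 n.
- have n1 : (0 < n - (size l1).+1)%N by lia.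
  have [|l3 [x [l4 [-> h3 h4]]]] := split_seq n1 m0 (l := l2); first by lia.
  rewrite -!cat_cons !catA !FK ?size_cat /=; try by lia.
  by apply: K1; lia.
- have n1 : (0 < (size l1).+1 - n)%N by lia.
  have [|l3 [x [l4 [lE h3 h4]]]] := split_seq n0 n1 (l := l1); first by lia.
  rewrite lE -!catA !cat_cons !FK //; apply: K3; lia.
- by rewrite !FK //; apply: K2.
Qed.

Lemma ev_mlin :
  (forall T : tree unit, mlin_on (leaves T).-1 (ev T)) /\
  (forall (B : branches unit) r, mlin_on (bleaves B).-1 (evB B r)).
Proof.
have succU_mlin T n (F : seq V -> R) y : mlin_on n F -> leaves T = n.+1 ->
    mlin_on n (fun l => succU T (F l) y).
  case: T => [|T0 v B] Fl nE l1 l2 a w z E; first by case: nE => nE; lia.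
  by rewrite /= Fl // succl.
apply: tree_mutind => [l1 l2 a u v //|T0 IT v B IB|T IT r|T IT v C IC r].
- apply: (mlin_split (K := fun l0 x l1 => evB B (succU T0 (ev T0 l0) (phi x)) l1)).
  + by move=> l0 x l1; apply: ev_Node.
  + move=> x l1 l2 l3 a u w E.
    by rewrite (succU_mlin _ _ _ _ IT) ?evB_linear //; have := (leaves_gt0 _).1 T0; lia.
  + by move=> l0 l1 a x y; rewrite phil succU_linear evB_linear.
  + by move=> l0 x; apply: IB.
  + exact: (leaves_gt0 _).1.
  + exact: (leaves_gt0 _).2.
- move=> l1 l2 a u w E; move: IT E; case: T => [|T0 v B] // IT E.
  have EL l : evB (Last (Node T0 v B)) r l = prec r (ev (Node T0 v B) l) by [].
  by rewrite !EL IT // precr.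
- apply: (mlin_split (K := fun l0 x l1 => dot r (evB C (succU T (ev T l0) (phi x)) l1))).
  + by move=> l0 x l1; apply: evB_Cons.
  + move=> x l1 l2 l3 a u w E.
    by rewrite (succU_mlin _ _ _ _ IT) ?evB_linear ?dotr //; have := (leaves_gt0 _).1 T; lia.
  + by move=> l0 l1 a x y; rewrite phil succU_linear evB_linear dotr.
  + by move=> l0 x l1 l2 a u w E; rewrite IC // dotr.
  + exact: (leaves_gt0 _).1.
  + exact: (leaves_gt0 _).2.
Qed.

(** The linear map on a tensor power with given values on pure tensors. *)
Fixpoint mlift (n : nat) (F : seq V -> R) : tpow V n -> R :=
  match n return tpow V n -> R with
  | 0 => fun c => (c : k) *: F [::]
  | m.+1 => tens_lift (fun v x => @mlift m (fun l => F (v :: l)) x)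
  end.

Lemma mliftP n F : mlin_on n F ->
  linear (@mlift n F) /\ forall l, size l = n -> mlift F (pure n l) = F l.
Proof.
elim: n F => [|n IH] F Fl.
  split=> [a x y|[|//] _ /=]; first by rewrite /= scalerDl scalerA.
  by rewrite scale1r.
have Fv v : mlin_on n (fun l => F (v :: l)).
  by move=> l1 l2 a u w E; apply: (Fl (v :: l1)); rewrite /= addSn E.
have bil : is_bilinear (fun v (x : tpow V n) => mlift (fun l => F (v :: l)) x).
  split=> [x a u v|v]; last exact: (IH _ (Fv v)).1.
  move: x; apply: tpow_ind => [|l ln].
    apply: subspace_eq; first exact: (IH _ (Fv _)).1.
    exact: linear_D (linear_Z a (IH _ (Fv u)).1) (IH _ (Fv v)).1.
  by rewrite !(IH _ (Fv _)).2 // (Fl [::]) //= ln.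
split=> [|[//|v l] [ln]]; first exact: tens_lift_linear.
by rewrite /= tens_liftE //; apply: (IH _ (Fv v)).2.
Qed.

Definition Pbar_ev (x : Pbar V) : R :=
  dsum_lift (fun n (p : PV V n.+1) => tens_lift (fun (t : kD k n.+1) y =>
    dsum_lift (fun (T : treeD n.+1) (c : k^o) => (c : k) *: @mlift n.+1 (ev (val T)) y) t)
  p) x.

Let mlift_ev n (T : treeD n) : linear (@mlift n (ev (val T))).
Proof. by apply: (mliftP _).1; have := ev_mlin.1 (val T); rewrite (eqP (valP T)). Qed.

Let Fc n (T : treeD n) y : linear (fun c : k^o => (c : k) *: @mlift n (ev (val T)) y).
Proof. by move=> a b c; rewrite scalerDl scalerA. Qed.

Let Fb n : is_bilinear (fun (t : kD k n) y =>
  dsum_lift (fun (T : treeD n) (c : k^o) => (c : k) *: @mlift n (ev (val T)) y) t).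
Proof.
split=> [y|t a x y] /=; first by apply: (@dsum_lift_linear _ _ (fun=> k^o)) => T; apply: Fc.
rewrite -(@dsum_lift_linf _ _ (fun=> k^o)); try by move=> T; apply: Fc.
congr dsum_lift; apply: functional_extensionality_dep => T; apply/funext => c.
by rewrite mlift_ev scalerDr !scalerA mulrC.
Qed.

Let Fn n : linear (fun p : PV V n => tens_lift (fun (t : kD k n) y =>
  dsum_lift (fun (T : treeD n) (c : k^o) => (c : k) *: @mlift n (ev (val T)) y) t) p).
Proof. exact: tens_lift_linear. Qed.

Lemma Pbar_ev_linear : linear Pbar_ev.
Proof. by apply: dsum_lift_linear => n; apply: Fn. Qed.

Lemma Pbar_ev_deco S l : fits S l -> Pbar_ev (deco S l) = ev S l.
Proof.
move=> gS; have [n ln] := fits_size gS; rewrite (decoE S ln) /Pbar_ev.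
rewrite (dsum_liftE _ (fun n => Fn (n := n.+1))) tens_liftE //.
have hS : leaves S == n.+2 by rewrite gS.2 ln.
have [T TS ->] := kD_basisE k hS.
rewrite (@dsum_liftE _ _ (fun=> k^o)); last by move=> T'; apply: Fc.
have FT : mlin_on n.+1 (ev (val T)).
  by have := ev_mlin.1 (val T); rewrite (eqP (valP T)).
by rewrite scale1r (mliftP FT).2 // TS.
Qed.

Lemma Pbar_ev_i_V v : Pbar_ev (i_V v) = phi v.
Proof. by rewrite i_VE Pbar_ev_deco. Qed.

Lemma Pbar_ev_op op opR : substar op -> is_bilinear opR ->
  (forall S S' l l', fits S l -> fits S' l' ->
    \sum_(U <- op S S') ev U (l ++ l') = opR (ev S l) (ev S' l')) ->
  {morph Pbar_ev : x y / Pbar_op op x y >-> opR x y}.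
Proof.
move=> sop [ol or'] opE x y; have [pl pr] := @Pbar_op_bilinear _ V op.
have el := Pbar_ev_linear.
move: x; apply: Pbar_ind => [|S l gS].
  by apply: subspace_eq => a u v; rewrite ?pl ?el ?ol.
move: y; apply: Pbar_ind => [|S' l' gS'].
  by apply: subspace_eq => a u v; rewrite ?pr ?el ?or'.
rewrite Pbar_op_deco // (lin_sum el) !Pbar_ev_deco // -opE //.
rewrite big_seq [RHS]big_seq; apply: eq_bigr => U /(fits_op sop gS gS') gU.
by rewrite Pbar_ev_deco.
Qed.

Lemma Pbar_ev_morph :
  [/\ {morph Pbar_ev : x y / Pbar_prec x y >-> prec x y},
      {morph Pbar_ev : x y / Pbar_succ x y >-> succ x y} &
      {morph Pbar_ev : x y / Pbar_dot x y >-> dot x y}].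
Proof.
have H S S' l l' (gS : fits S l) (gS' : fits S' l') :=
  let: And3 _ _ h := ev_star.1 S S' l l' gS.2 gS'.2 in h gS.1 gS'.1.
split; [apply: (Pbar_ev_op substar_prec (td_precB tdR))
  | apply: (Pbar_ev_op substar_succ (td_succB tdR))
  | apply: (Pbar_ev_op substar_dot (td_dotB tdR))] => S S' l l' gS gS';
  by case: (H S S' l l' gS gS').
Qed.

End Evaluation.

(** * Generation by the trees with one angle *)

Section Generation.
Variables (k : fieldType) (V : lmodType k).

(** The trees T[v] generate: the decomposition of a tree that defines [ev] is
    already valid in the free algebra, with a single term in each product. *)
Lemma Pbar_gen_ind (P : Pbar V -> Prop) : subspace P ->
  (forall v, P (i_V v)) ->
  (forall x y, P x -> P y -> P (Pbar_prec x y)) ->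
  (forall x y, P x -> P y -> P (Pbar_succ x y)) ->
  (forall x y, P x -> P y -> P (Pbar_dot x y)) ->
  forall x, P x.
Proof.
move=> sP Pi Pp Ps Pd; apply: Pbar_ind => // S l.
pose root T := Node T tt (Last Leaf).
have rootP T l0 x : (fits T l0 -> P (deco T l0)) -> leaves T = (size l0).+1 ->
    P (deco (root T) (rcons l0 x)).
  case: T => [|T0 u B] PT TE; first by case: l0 TE {PT} => // _; apply: Pi.
  have gT : fits (Node T0 u B) l0 by [].
  have := Ps _ _ (PT gT) (Pi x); rewrite i_VE /Pbar_succ Pbar_op_deco //.
  by rewrite sum_succ starT0 big_seq1 cats1.
have fits_root T l0 (x : V) : leaves T = (size l0).+1 -> fits (root T) (rcons l0 x).
  by move=> TE; split; rewrite //= TE size_rcons addn1.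
move: S l; suff [H _] :
  (forall S l, fits S l -> P (deco S l)) /\
  (forall B T l0 l, fits (root T) l0 -> P (deco (root T) l0) ->
    bleaves B = (size l).+1 -> P (deco (Node T tt B) (l0 ++ l))) by [].
apply: tree_mutind => [l []//|T IT [] B IB l [_ lE]|T IT S l0 l gS PS lE
  |T IT [] C IC S l0 l gS PS lE].
- have [l0 [x [l1 [-> h0 h1]]]] :=
    split_seq ((leaves_gt0 _).1 T) ((leaves_gt0 _).2 B) lE.
  by rewrite -cat_rcons; apply: IB => //; [apply: fits_root | apply: rootP; auto].
- case: T IT lE => [_|T0 u B IT lE].
    by case: l => // _; rewrite cats0.
  have gT : fits (Node T0 u B) l by [].
  have := Pp _ _ PS (IT _ gT); rewrite /Pbar_prec Pbar_op_deco //.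
  by rewrite sum_prec [bstar _ _]/= big_seq1.
- have [l2 [x [l3 [-> h2 h3]]]] :=
    split_seq ((leaves_gt0 _).1 T) ((leaves_gt0 _).2 C) lE.
  have gC : fits (Node T tt C) (rcons l2 x ++ l3).
    by split; rewrite //= size_cat size_rcons h2 h3 addnS.
  have PC : P (deco (Node T tt C) (rcons l2 x ++ l3)).
    by apply: IC => //; [apply: fits_root | apply: rootP; auto].
  have := Pd _ _ PS PC; rewrite /Pbar_dot Pbar_op_deco //.
  by rewrite sum_dot [bstar _ _]/= big_seq1 cat_rcons.
Qed.

Variable s : tens V V -> tens V V.
Hypothesis sb : is_braiding s.
Variables (R : lmodType k) (tau : tens R R -> tens R R).
Hypothesis taul : linear tau.
Variable phi : V -> R.
Hypothesis phib : is_braided_hom s tau phi.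
Variable f : Pbar V -> R.
Hypothesis fl : linear f.
Hypothesis fi : forall v, f (i_V v) = phi v.

Let sATl : linear (sigmaAT s) := sigmaAT_linear sb.1.
Let ffl : linear (tmap f f) := tmap_linear fl fl.

(** Where [f] commutes with the braidings, a decomposition on the source side
    gives one on the target side. *)
Lemma tmap_tau (x y : Pbar V) I (r : seq I) (F G : I -> Pbar V) :
  tmap f f (sigmaAT s (x ⊗ y)) = tau (f x ⊗ f y) ->
  sigmaAT s (x ⊗ y) = \sum_(i <- r) F i ⊗ G i ->
  tau (f x ⊗ f y) = \sum_(i <- r) f (F i) ⊗ f (G i).
Proof.
by move=> <- ->; rewrite (lin_sum ffl); apply: eq_bigr => i _; rewrite tmapE.
Qed.

(** Commutation with the braidings when the left factor is a generator. To
    iterate the compatibilities, the braiding has to return generators, hence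
    the first clause. *)
Definition braidsl (y : Pbar V) : Prop := forall v,
  (exists r : seq (Pbar V * V), sigmaAT s (i_V v ⊗ y) = \sum_(p <- r) p.1 ⊗ i_V p.2)
  /\ tmap f f (sigmaAT s (i_V v ⊗ y)) = tau (f (i_V v) ⊗ f y).

Definition braids (x : Pbar V) : Prop := forall y,
  tmap f f (sigmaAT s (x ⊗ y)) = tau (f x ⊗ f y).

Lemma braidsl_subspace : subspace braidsl.
Proof.
have R0 v : i_V v ⊗ 0 = 0 :> tens (Pbar V) (Pbar V).
  exact: (lin0 (linear_tensorr _)).
split=> [v|a x y Hx Hy v].
  rewrite R0 (lin0 sATl) (lin0 ffl) (lin0 fl) (lin0 (linear_tensorr _)) (lin0 taul).
  by split=> //; exists [::]; rewrite big_nil.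
have [[r rE] Ex] := Hx v; have [[q qE] Ey] := Hy v; split; last first.
  by rewrite linear_tensorr sATl ffl Ex Ey fl linear_tensorr taul.
exists ([seq (a *: p.1, p.2) | p <- r] ++ q).
rewrite linear_tensorr sATl rE qE big_cat big_map /= scaler_sumr.
by congr (_ + _); apply: eq_bigr => p _; rewrite (linZ (linear_tensorl _)).
Qed.

Lemma braids_subspace : subspace braids.
Proof.
split=> [y|a x z Hx Hz y].
  by rewrite (lin0 fl) !(lin0 (linear_tensorl _)) (lin0 sATl) (lin0 ffl) (lin0 taul).
by rewrite linear_tensorl sATl ffl Hx Hz fl linear_tensorl taul.
Qed.

Section Closed.
Variables (op : tree unit -> tree unit -> seq (tree unit)) (opR : R -> R -> R).
Hypothesis sop : substar op.
Hypothesis opRb : is_bilinear opR.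
Hypothesis opRc : braiding_compat tau opR.
Hypothesis fop : {morph f : x y / Pbar_op op x y >-> opR x y}.

Let opb := @Pbar_op_bilinear k V op.
Let opc : braiding_compat (sigmaAT s) (Pbar_op op) := sigmaAT_compat sb sop.

Lemma braidsl_op x y : braidsl x -> braidsl y -> braidsl (Pbar_op op x y).
Proof.
move=> Hx Hy v; have [[r rE] Ex] := Hx v.
have [q qE] := choice (fun w => (Hy w).1).
have E : sigmaAT s (i_V v ⊗ Pbar_op op x y) =
    \sum_(p <- r) \sum_(o <- q p.2) Pbar_op op p.1 o.1 ⊗ i_V o.2.
  rewrite -(tmap_opr opb) opc.1.
  exact: (hexagonrE sATl opb rE (fun p => qE p.2)).
split.
  exists [seq (Pbar_op op p.1 o.1, o.2) | p <- r, o <- q p.2].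
  by rewrite E big_allpairs_dep.
rewrite E fop -(tmap_opr opRb) opRc.1.
rewrite (hexagonrE taul opRb (tmap_tau Ex rE)
  (fun p => tmap_tau (Hy p.2).2 (qE p.2))).
rewrite (lin_sum ffl); apply: eq_bigr => p _.
rewrite (lin_sum ffl); apply: eq_bigr => o _.
by rewrite tmapE // fop.
Qed.

Lemma braids_op x y : braids x -> braids y -> braids (Pbar_op op x y).
Proof.
move=> Hx Hy z.
have E1 := trepr_sum (sigmaAT s (y ⊗ z)).
have E2 (p : Pbar V * Pbar V) := trepr_sum (sigmaAT s (x ⊗ p.1)).
rewrite -(tmap_opl opb) opc.2 (hexagonlE sATl opb E1 E2) fop.
rewrite -(tmap_opl opRb) opRc.2.
rewrite (hexagonlE taul opRb (tmap_tau (Hy z) E1)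
  (fun p => tmap_tau (Hx p.1) (E2 p))).
rewrite (lin_sum ffl); apply: eq_bigr => p _.
rewrite (lin_sum ffl); apply: eq_bigr => o _.
by rewrite tmapE // fop.
Qed.

End Closed.

Lemma braidsl_i_V v : braidsl (i_V v).
Proof.
move=> u; split.
  exists [seq (i_V p.1, p.2) | p <- braid_vv s u v].
  by rewrite big_map; apply: (sigmaAT_i_V sb).
have phil := phib.1.
rewrite (sigmaAT_i_V sb) !fi -(tmapE _ _ phil phil) -phib.2 (braid_vv_sum s).
rewrite (lin_sum ffl) (lin_sum (tmap_linear phil phil)).
by apply: eq_bigr => p _; rewrite !tmapE // !fi.
Qed.

Variables prec succ dot : R -> R -> R.
Hypothesis bR : is_braided_tridendriform prec succ dot tau.
Hypothesis fp : {morph f : x y / Pbar_prec x y >-> prec x y}.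
Hypothesis fs : {morph f : x y / Pbar_succ x y >-> succ x y}.
Hypothesis fd : {morph f : x y / Pbar_dot x y >-> dot x y}.

(** First [braidsl] is propagated from generators to all right factors; with the
    right factor arbitrary, commutation is then propagated to all left
    factors. *)
Lemma morph_braided : is_braided_hom (sigmaAT s) tau f.
Proof.
have [pb sb' db] : [/\ is_bilinear prec, is_bilinear succ & is_bilinear dot].
  by case: (btd_tridendriform bR).
have [_ _ pc sc dc] := bR.
have Hl y : braidsl y.
  move: y; apply: Pbar_gen_ind => [|v|x y|x y|x y].
  - exact: braidsl_subspace.
  - exact: braidsl_i_V.
  - exact: (braidsl_op substar_prec pb pc fp).
  - exact: (braidsl_op substar_succ sb' sc fs).
  - exact: (braidsl_op substar_dot db dc fd).
have H x : braids x.
  move: x; apply: Pbar_gen_ind => [|v y|x y|x y|x y].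
  - exact: braids_subspace.
  - exact: (Hl y v).2.
  - exact: (braids_op substar_prec pb pc fp).
  - exact: (braids_op substar_succ sb' sc fs).
  - exact: (braids_op substar_dot db dc fd).
split=> //; apply: tens_lift_unique => [||x y].
- exact: linear_comp ffl sATl.
- exact: linear_comp taul ffl.
by rewrite H tmapE.
Qed.

End Generation.

(** * The universal property *)

Theorem theorem4p5 (k : fieldType) (k_char0 : [pchar k] =i pred0)
    (V : lmodType k) (sigma : tens V V -> tens V V)
    (sigma_braiding : is_braiding sigma) :
  [/\ is_braided_tridendriform (@Pbar_prec k V) (@Pbar_succ k V)
        (@Pbar_dot k V) (sigmaAT sigma),
      is_braided_hom sigma (sigmaAT sigma) (@i_V k V) &
      forall (R : lmodType k) (precR succR dotR : R -> R -> R)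
             (tau : tens R R -> tens R R),
        is_braided_tridendriform precR succR dotR tau ->
        forall phi : V -> R, is_braided_hom sigma tau phi ->
        exists! phibar : Pbar V -> R,
          is_braided_tridendriform_hom
            (@Pbar_prec k V) (@Pbar_succ k V) (@Pbar_dot k V) (sigmaAT sigma)
            precR succR dotR tau phibar /\
          phi =1 phibar \o @i_V k V].
Proof.
split; [exact: Pbar_braided_tridendriform | exact: i_V_braided_hom |].
move=> R prec succ dot tau bR phi phib.
have [tdR [taul _] _ _ _] := bR; have phil := phib.1.
have [Ep Es Ed] := Pbar_ev_morph tdR phil.
have El := Pbar_ev_linear tdR phil.
have Ei := Pbar_ev_i_V tdR phil.
exists (Pbar_ev prec succ dot phi); split.
  split; last by move=> v; rewrite /= Ei.
  by split=> //; apply: (morph_braided sigma_braiding taul phib El Ei bR).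
move=> g [[[gl _] gp gs gd] gphi]; apply/funext; apply: Pbar_gen_ind.
- exact: subspace_eq.
- by move=> v; rewrite Ei gphi.
- by move=> x y Ex Ey; rewrite Ep gp Ex Ey.
- by move=> x y Ex Ey; rewrite Es gs Ex Ey.
- by move=> x y Ex Ey; rewrite Ed gd Ex Ey.
Qed.
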